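(* Let $\Gamma$ be a (countable discrete) hyperlinear group with Kazhdan's property (T). If $\Gamma$ is weakly ucp-stable, then $\Gamma$ is residually finite.
   Context: For a finite-dimensional Hilbert space $\mathcal{H}$ of dimension $d$ and $x \in B(\mathcal{H})$, $\tau_d(x) = \frac1d \mathrm{Tr}(x)$ and $\|x\|_{2,\tau_d} = \tau_d(x^*x)^{1/2}$ (normalized Hilbert–Schmidt norm). $U(\mathcal{H})$ is the unitary group of $\mathcal{H}$ and $U(d) = U(\mathbb{C}^d)$. Hyperlinear: a group $G$ is hyperlinear if for every $\epsilon>0$ and every finite subset $F \subset G$ there exist $d \in \mathbb{N}$ and a map $\varphi: F \to U(d)$ such that $\|\varphi(g)\varphi(h) - \varphi(gh)\|_{2,\tau_d} < \epsilon$ for all $g,h \in F$ with $gh \in F$, and $\|\varphi(g) - 1\|_{2,\tau_d} > \sqrt{2} - \epsilon$ for all $g \in F \setminus \{1_G\}$. Hyperlinear approximation of a countable group $\Gamma$: a sequence of maps $\varphi_n : \Gamma \to U(\mathcal{H}_n)$, with $\mathcal{H}_n$ finite-dimensional Hilbert spaces of dimension $d_n$, such that $\lim_n \|\varphi_n(g)\varphi_n(h) - \varphi_n(gh)\|_{2,\tau_{d_n}} = 0$ for all $g,h \in \Gamma$ and $\liminf_n \|\varphi_n(g) - 1\|_{2,\tau_{d_n}} \ge \sqrt{2}$ for every $1 \ne g \in \Gamma$. Weakly ucp-stable: a countable group $\Gamma$ is weakly ucp-stable if for every hyperlinear approximation $\varphi_n : \Gamma \to U(\mathcal{H}_n)$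 there exist (possibly infinite-dimensional) Hilbert spaces $\widehat{\mathcal{H}}_n \supseteq \mathcal{H}_n$ and homomorphisms $\pi_n : \Gamma \to U(\widehat{\mathcal{H}}_n)$ such that $\|\varphi_n(g) - P_n\pi_n(g)P_n\|_{2,\tau_{\dim \mathcal{H}_n}} \to 0$ as $n \to \infty$ for all $g \in \Gamma$, where $P_n$ is the orthogonal projection of $\widehat{\mathcal{H}}_n$ onto $\mathcal{H}_n$ (so $P_n\pi_n(g)P_n$ is regarded as an operator on $\mathcal{H}_n$). *)

(* Defs.v *)
From HB Require Import structures.
From mathcomp Require Import all_boot all_order all_algebra all_fingroup.
From mathcomp Require Import finmap complex.
From mathcomp Require Import all_classical all_reals all_analysis.

Set Implicit Arguments.
Unset Strict Implicit.
Unset Printing Implicit Defensive.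

Import Order.TTheory GRing.Theory Num.Theory.
Import numFieldNormedType.Exports.

Local Open Scope classical_set_scope.
Local Open Scope complex_scope.
Local Open Scope ring_scope.
Local Open Scope sesquilinear_scope.

(* Complex Hilbert spaces: the complex numbers are R[i], and the inner product,
   linear in its first argument, induces the norm of a complete normed module. *)
HB.mixin Record isHilbert (R : realType) H of CompleteNormedModule R[i] H := {
  dot : {dot H for (@Num.conj R[i])};
  normr_dot : forall x : H, `|x| ^+ 2 = dot x x
}.

#[short(type="hilbertType")]
HB.structure Definition Hilbert (R : realType) :=
  {H of isHilbert R H & CompleteNormedModule R[i] H}.

Definition dot_preserving (R : realType) (H K : hilbertType R) (f : H -> K) :=
  forall x y : H, dot (f x) (f y) = dot x y.

Definition unitary (R : realType) (H : hilbertType R) (u : H -> H) : Prop :=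
  [/\ linear u, dot_preserving u & forall y, exists x, u x = y].

Definition unitary_rep (R : realType) (G : groupType) (H : hilbertType R)
    (rho : G -> H -> H) : Prop :=
  (forall g, unitary (rho g)) /\
  (forall g h, rho (g * h)%g = rho g \o rho h).

Definition orthonormal_basis (R : realType) (H : hilbertType R) (d : nat)
    (e : 'I_d -> H) : Prop :=
  (forall i j, dot (e i) (e j) = (i == j)%:R) /\
  (forall x, exists c : 'I_d -> R[i], x = \sum_i c i *: e i).

Definition tau (R : realType) (d : nat) (A : 'M[R[i]]_d) : R[i] :=
  d%:R^-1 * \tr A.

(* tau (A^* A) is a nonnegative real, so taking its real part loses nothing. *)
Definition norm2 (R : realType) (d : nat) (A : 'M[R[i]]_d) : R :=
  Num.sqrt (complex.Re (tau (A ^t* *m A))).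

Definition mxop (R : realType) (H : hilbertType R) (d : nat) (e : 'I_d -> H)
    (T : H -> H) : 'M[R[i]]_d :=
  \matrix_(i, j) dot (T (e j)) (e i).

(* The value does not depend on the orthonormal basis e. *)
Definition norm2op (R : realType) (H : hilbertType R) (d : nat)
    (e : 'I_d -> H) (T : H -> H) : R :=
  norm2 (mxop e T).

Definition hyperlinear (R : realType) (G : groupType) : Prop :=
  forall eps : R, 0 < eps -> forall F : {fset G},
  exists (d : nat) (phi : G -> 'M[R[i]]_d),
    [/\ (0 < d)%N,
        forall g, g \in F -> phi g \is unitarymx,
        forall g h, g \in F -> h \in F -> (g * h)%g \in F ->
          norm2 (phi g *m phi h - phi (g * h)%g) < eps &
        forall g, g \in F -> g != 1%g ->
          Num.sqrt 2 - eps < norm2 (phi g - 1%:M)].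

(* The spaces H n are finite-dimensional of dimension d n, as witnessed by the
   orthonormal bases e n. *)
Definition hyperlinear_approximation (R : realType) (G : groupType)
    (H : nat -> hilbertType R) (d : nat -> nat) (e : forall n, 'I_(d n) -> H n)
    (phi : forall n, G -> H n -> H n) : Prop :=
  [/\ forall n, (0 < d n)%N /\ orthonormal_basis (e n),
      forall n g, unitary (phi n g),
      forall g h,
        norm2op (e n) ((phi n g \o phi n h) \- phi n (g * h)%g)
          @[n --> \oo] --> (0 : R) &
      forall g, g != 1%g ->
        ((Num.sqrt 2)%:E <=
           limn_einf (fun n => (norm2op (e n) (phi n g \- id))%:E))%E].

(* Along the inclusion iota : H -> K, the map P : K -> H is the orthogonal
   projection of K onto H, with values read in H rather than in K. *)
Definition orthogonal_projection (R : realType) (H K : hilbertType R)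
    (iota : H -> K) (P : K -> H) : Prop :=
  forall (v : K) (x : H), dot (v - iota (P v)) (iota x) = 0.

(* The inclusion of H n in a larger Hilbert space K n is an isometric linear
   embedding iota n. *)
Definition weakly_ucp_stable (R : realType) (G : groupType) : Prop :=
  forall (H : nat -> hilbertType R) (d : nat -> nat)
    (e : forall n, 'I_(d n) -> H n) (phi : forall n, G -> H n -> H n),
  hyperlinear_approximation e phi ->
  exists (K : nat -> hilbertType R) (iota : forall n, {linear H n -> K n})
    (P : forall n, K n -> H n) (rho : forall n, G -> K n -> K n),
    [/\ forall n, dot_preserving (iota n),
        forall n, orthogonal_projection (iota n) (P n),
        forall n, unitary_rep (rho n) &
        forall g,
          norm2op (e n) (phi n g \- (P n \o rho n g \o iota n))
            @[n --> \oo] --> (0 : R)].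

(* G is discrete, so its compact subsets are the finite ones. *)
Definition property_T (R : realType) (G : groupType) : Prop :=
  exists (F : {fset G}) (eps : R), 0 < eps /\
  forall (H : hilbertType R) (rho : G -> H -> H), unitary_rep rho ->
    (exists2 x : H, x != 0 &
       forall g, g \in F -> `|rho g x - x| < eps%:C * `|x|) ->
    exists2 y : H, y != 0 & forall g, rho g y = y.

Definition residually_finite (G : groupType) : Prop :=
  forall g : G, g != 1%g ->
  exists (K : finGroupType) (f : {multiplicative G -> K}), f g != 1%g.

(* Main.v *)
(** Suppose g0 <> 1 is killed by every homomorphism of G to a finite group and
    let N be the normal subgroup of all such elements.  Weak ucp-stability
    provides a unitary representation rho of G on K and a projection P of rank d
    whose compressions P rho(g) P are almost unitary in the normalized
    Hilbert-Schmidt norm, while P rho(g0) P stays away from P.  Let Q be the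
    projection onto the orthogonal complement of the N-fixed vectors.  Then P Q is
    almost invariant under conjugation by rho(g), and is not small since g0 lies
    in N.  By property (T), applied to the Hilbert-Schmidt operators that vanish
    on the N-fixed vectors, some nonzero operator T of this kind commutes with
    rho.  The top eigenspace of T^* T is a finite-dimensional subrepresentation;
    as G is finitely generated, again by property (T), Malcev's theorem shows that
    N acts trivially on it, so that T vanishes there: a contradiction. *)
From HB Require Import structures.
Require Import Defs.
From mathcomp Require Import all_boot all_order all_algebra all_fingroup.
From mathcomp Require Import finmap complex.
From mathcomp Require Import all_classical all_reals all_analysis.
From mathcomp Require Import fieldext galois finfield.
From mathcomp Require Import zify ring lra.

Set Implicit Arguments.
Unset Strict Implicit.
Unset Printing Implicit Defensive.

Import Order.TTheory GRing.Theory Num.Theory.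
Import numFieldNormedType.Exports.

Local Open Scope classical_set_scope.
Local Open Scope complex_scope.
Local Open Scope ring_scope.

(** P alone is almost invariant: in the unnormalized norm, || rho(g) P rho(g)^* - P ||^2 = 2 (d - ||
    P rho(g) P ||^2). But property (T) yields some invariant operator with no control on its
    distance to P, and that operator could live on the N-fixed vectors, about which finite quotients
    say nothing. Hence the passage to P Q, and hence a space of operators in which vanishing on the
    N-fixed vectors is built in. As N is normal, Q commutes with rho, so conjugation acts on this
    space and P Q inherits the bound of P. It is not small because rho(g0) - 1 vanishes on the
    N-fixed vectors, whence || P (rho(g0) - 1) P || <= 2 || P Q ||. The space K may be
    infinite-dimensional. Hilbert-Schmidt operators suit it twice: conjugation is unitary on them,
    and every unit eigenvector of T^* T for its top eigenvalue contributes that eigenvalue to the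
    finite squared norm of T, so the eigenspace has finite dimension. *)

Local Notation Re := complex.Re.
Local Notation Im := complex.Im.


(** * Complex numbers and semi-inner products *)

Section ComplexNumbers.
Variable R : realType.
Implicit Types (z w : R[i]) (t : R).

Lemma complex_eqP z w : Re z = Re w -> Im z = Im w -> z = w.
Proof. by case: z w => [a b] [c d] /= -> ->. Qed.

Lemma cReD z w : Re (z + w) = Re z + Re w.
Proof. by case: z w => [a b] [c d]. Qed.

Lemma cImD z w : Im (z + w) = Im z + Im w.
Proof. by case: z w => [a b] [c d]. Qed.

Lemma cReN z : Re (- z) = - Re z. Proof. by case: z. Qed.

Lemma cImN z : Im (- z) = - Im z. Proof. by case: z. Qed.

Lemma cReM z w : Re (z * w) = Re z * Re w - Im z * Im w.
Proof. by case: z w => [a b] [c d]. Qed.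

Lemma cImM z w : Im (z * w) = Re z * Im w + Im z * Re w.
Proof. by case: z w => [a b] [c d]. Qed.

Lemma cRe_conj z : Re (Num.conj z) = Re z.
Proof. by case: z. Qed.

Lemma cIm_conj z : Im (Num.conj z) = - Im z.
Proof. by case: z. Qed.

Lemma cRe_sum (I : Type) (r : seq I) (P : pred I) (F : I -> R[i]) :
  Re (\sum_(i <- r | P i) F i) = \sum_(i <- r | P i) Re (F i).
Proof. exact: (big_morph (@complex.Re R) (@cReD) erefl). Qed.

(** Real-valued, so that estimates take place in the totally ordered field [R] and not in [R[i]]. *)
Definition normsq z : R := Re z ^+ 2 + Im z ^+ 2.

Lemma normsq_ge0 z : 0 <= normsq z.
Proof. by rewrite addr_ge0 ?sqr_ge0. Qed.

Lemma mul_conj_normsq z : z * Num.conj z = (normsq z)%:C.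
Proof. by apply: complex_eqP; rewrite ?cReM ?cImM cRe_conj cIm_conj /normsq /=; ring. Qed.

Lemma normsq_eq0 z : normsq z = 0 -> z = 0.
Proof.
move=> /eqP; rewrite paddr_eq0 ?sqr_ge0// !sqrf_eq0 => /andP[/eqP a /eqP b].
exact: complex_eqP.
Qed.

End ComplexNumbers.

Lemma invS_eventually_le (R : realType) (e : R) : 0 < e ->
  exists N, forall n, (N <= n)%N -> n.+1%:R^-1 <= e.
Proof.
move=> e0; exists (Num.truncn e^-1).+1 => n Nn.
rewrite -[leRHS]invrK lef_pV2 ?posrE ?invr_gt0//.
apply: le_trans (ltW (truncnS_gt _)) _; rewrite ler_nat.
exact: leq_trans Nn _.
Qed.

Section SemiInnerProducts.
Variables (R : realType) (V : lmodType R[i]) (f : V -> V -> R[i]).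
Hypothesis f_lin : forall w a u v, f (a *: u + v) w = a * f u w + f v w.
Hypothesis f_conj : forall u v, f v u = Num.conj (f u v).
Hypothesis f_ge0 : forall v, 0 <= Re (f v v).

Lemma formDl u v w : f (u + v) w = f u w + f v w.
Proof. by have := f_lin w 1 u v; rewrite scale1r mul1r. Qed.

Lemma form0l w : f 0 w = 0.
Proof. by apply: (addIr (f 0 w)); rewrite -formDl !add0r. Qed.

Lemma formZl a u w : f (a *: u) w = a * f u w.
Proof. by have := f_lin w a u 0; rewrite form0l !addr0. Qed.

Lemma formNl u w : f (- u) w = - f u w.
Proof. by rewrite -scaleN1r formZl mulN1r. Qed.

Lemma formBl u v w : f (u - v) w = f u w - f v w.
Proof. by rewrite formDl formNl. Qed.

Lemma formDr u v w : f w (u + v) = f w u + f w v.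
Proof. by rewrite f_conj formDl rmorphD /= -!f_conj. Qed.

Lemma form0r w : f w 0 = 0.
Proof. by rewrite f_conj form0l rmorph0. Qed.

Lemma formZr a u w : f w (a *: u) = Num.conj a * f w u.
Proof. by rewrite f_conj formZl rmorphM /= -f_conj. Qed.

Lemma formNr u w : f w (- u) = - f w u.
Proof. by rewrite -scaleN1r formZr rmorphN rmorph1 mulN1r. Qed.

Lemma formBr u v w : f w (u - v) = f w u - f w v.
Proof. by rewrite formDr formNr. Qed.

Lemma form_suml (I : Type) (r : seq I) (P : pred I) (F : I -> V) w :
  f (\sum_(i <- r | P i) F i) w = \sum_(i <- r | P i) f (F i) w.
Proof. by apply: (big_morph (f^~ w)) => [u v|]; rewrite ?formDl ?form0l. Qed.

Lemma form_sumr (I : Type) (r : seq I) (P : pred I) (F : I -> V) w :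
  f w (\sum_(i <- r | P i) F i) = \sum_(i <- r | P i) f w (F i).
Proof. by apply: (big_morph (f w)) => [u v|]; rewrite ?formDr ?form0r. Qed.

Lemma Re_formC u v : Re (f u v) = Re (f v u).
Proof. by rewrite f_conj cRe_conj. Qed.

Lemma Im_form v : Im (f v v) = 0.
Proof. by have /(congr1 (@complex.Im R)) := f_conj v v; rewrite cIm_conj; lra. Qed.

Lemma form_real v : f v v = (Re (f v v))%:C.
Proof. by apply: complex_eqP => //=; rewrite Im_form. Qed.

Local Notation q v := (Re (f v v)).

Lemma sq_formD u v : q (u + v) = q u + q v + 2 * Re (f u v).
Proof. by rewrite formDl !formDr !cReD (Re_formC v u); ring. Qed.

Lemma sq_formN v : q (- v) = q v.
Proof. by rewrite formNl formNr opprK. Qed.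

Lemma sq_formB u v : q (u - v) = q u + q v - 2 * Re (f u v).
Proof. by rewrite sq_formD sq_formN formNr cReN; ring. Qed.

Lemma sq_formZ a v : q (a *: v) = normsq a * q v.
Proof. by rewrite formZl formZr mulrA mul_conj_normsq cReM /=; ring. Qed.

Lemma parallelogram u v : q (u + v) + q (u - v) = 2 * (q u + q v).
Proof. by rewrite sq_formD sq_formB; ring. Qed.

Lemma sq_formD_le u v : q (u + v) <= 2 * (q u + q v).
Proof. by have := parallelogram u v; have := f_ge0 (u - v); lra. Qed.

Lemma cauchy_schwarz_Re u v : Re (f u v) ^+ 2 <= q u * q v.
Proof.
have H (t : R) : 0 <= q u + t ^+ 2 * q v + 2 * (t * Re (f u v)).
  have := f_ge0 (u + t%:C *: v).
  by rewrite sq_formD sq_formZ formZr cReM cRe_conj cIm_conj /normsq /=; nra.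
have [qv0|qv0] := eqVneq (q v) 0.
  rewrite qv0 mulr0 leNgt; apply/negP => r0.
  have rn0 : Re (f u v) != 0 by apply: contraTneq r0 => ->; rewrite expr0n ltxx.
  (* With [q v = 0] the expression in [H] is affine in [t]; this [t] gives it the value -1. *)
  have := H (- (q u + 1) / (2 * Re (f u v))).
  rewrite qv0 mulr0 addr0.
  have -> : 2 * (- (q u + 1) / (2 * Re (f u v)) * Re (f u v)) = - (q u + 1).
    by field.
  lra.
have qvp : 0 < q v by rewrite lt_def qv0 f_ge0.
have := H (- Re (f u v) / q v).
have -> : q u + (- Re (f u v) / q v) ^+ 2 * q v + 2 * (- Re (f u v) / q v * Re (f u v))
   = (q u * q v - Re (f u v) ^+ 2) / q v by field.
by rewrite pmulr_lge0 ?invr_gt0// subr_ge0.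
Qed.

Lemma Re_form_le u v : Re (f u v) <= Num.sqrt (q u) * Num.sqrt (q v).
Proof.
rewrite -sqrtrM//; apply: le_trans (ler_norm _) _.
by rewrite -sqrtr_sqr ler_wsqrtr// cauchy_schwarz_Re.
Qed.

Lemma sqrt_formD u v :
  Num.sqrt (q (u + v)) <= Num.sqrt (q u) + Num.sqrt (q v).
Proof.
apply: le_trans (_ : Num.sqrt ((Num.sqrt (q u) + Num.sqrt (q v)) ^+ 2) <= _).
  rewrite ler_wsqrtr// sq_formD sqrrD !sqr_sqrtr//.
  by have := Re_form_le u v; lra.
by rewrite sqrtr_sqr ger0_norm// addr_ge0 ?sqrtr_ge0.
Qed.

Lemma form_eq0 u v : q v = 0 -> f u v = 0.
Proof.
move=> qv0.
have H w : q w = 0 -> Re (f u w) = 0.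
  move=> qw; apply/eqP; rewrite -sqrf_eq0 eq_le sqr_ge0 andbT.
  by have := cauchy_schwarz_Re u w; rewrite qw mulr0.
apply: complex_eqP; first exact: H.
have := H ('i%C *: v); rewrite sq_formZ qv0 mulr0 => /(_ erefl).
by rewrite formZr cReM cRe_conj cIm_conj /=; lra.
Qed.

(** Scaling [u] by the conjugate of [f u v] turns the value of the form into the real number
    [normsq (f u v)], to which the bound on real parts applies. *)
Lemma cauchy_schwarz u v : normsq (f u v) <= q u * q v.
Proof.
have [/eqP|] := eqVneq (normsq (f u v)) 0.
  by move=> /eqP ->; rewrite mulr_ge0.
move=> nz; have np : 0 < normsq (f u v) by rewrite lt_def nz normsq_ge0.
have := cauchy_schwarz_Re (Num.conj (f u v) *: u) v.
rewrite formZl mulrC mul_conj_normsq sq_formZ /=.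
have -> : normsq (Num.conj (f u v)) = normsq (f u v).
  by rewrite /normsq cRe_conj cIm_conj sqrrN.
by rewrite expr2 -mulrA ler_pM2l.
Qed.

End SemiInnerProducts.

(** * Hilbert spaces from directed families of semi-inner products *)

(* The vectors of the subspace [df_dom] on which the forms are uniformly bounded
   make up a Hilbert space whose squared norm is the supremum of the forms.  This
   yields l^2-spaces (forms: finite partial sums) and Hilbert-Schmidt operators
   (forms: sums over finite orthonormal lists) without any infinite sum. *)
Record directed_forms (R : realType) (V : lmodType R[i]) := DirectedForms {
  df_dom : V -> Prop;
  df_idx : Type;
  df_form : df_idx -> V -> V -> R[i];
  df_idx0 : df_idx;
  df_dom0 : df_dom 0;
  df_domP : forall a u v, df_dom u -> df_dom v -> df_dom (a *: u + v);
  df_lin : forall i w a u v,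
    df_form i (a *: u + v) w = a * df_form i u w + df_form i v w;
  df_conj : forall i u v, df_form i v u = Num.conj (df_form i u v);
  df_ge0 : forall i v, 0 <= Re (df_form i v v);
  df_directed : forall i j, exists k, forall v, df_dom v ->
    Re (df_form i v v) <= Re (df_form k v v) /\
    Re (df_form j v v) <= Re (df_form k v v);
  df_sep : forall v, df_dom v -> (forall i, Re (df_form i v v) = 0) -> v = 0;
  df_complete : forall u : nat -> V, (forall n, df_dom (u n)) ->
    (forall e : R, 0 < e -> exists N, forall m n, (N <= m)%N -> (N <= n)%N ->
      forall i, Re (df_form i (u m - u n) (u m - u n)) <= e) ->
    exists2 v, df_dom v &
      forall i (e : R), 0 < e -> exists N, forall n, (N <= n)%N ->
        Re (df_form i (u n - v) (u n - v)) <= e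
}.

Section DirectedForms.
Variables (R : realType) (V : lmodType R[i]) (D : directed_forms V).

Definition df_sq (i : df_idx D) (v : V) : R := Re (df_form i v v).

Definition df_bounded (v : V) := exists M, forall i, df_sq i v <= M.

Let lin i := @df_lin R V D i.
Let conj i := @df_conj R V D i.
Let ge0 i := @df_ge0 R V D i.

Definition df_pred : {pred V} := fun v => `[<df_dom D v /\ df_bounded v>].

Lemma df_predP v : reflect (df_dom D v /\ df_bounded v) (v \in df_pred).
Proof. exact: asboolP. Qed.

Lemma df_submod : GRing.submod_closed df_pred.
Proof.
split.
  apply/df_predP; split; first exact: df_dom0.
  by exists 0 => i; rewrite /df_sq (form0l (lin i)).
move=> a u v /df_predP[du [M Mu]] /df_predP[dv [N Nv]]; apply/df_predP; split.
  exact: df_domP.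
exists (2 * (normsq a * M + N)) => i.
have := sq_formD_le (lin i) (conj i) (ge0 i) (a *: u) v.
rewrite (sq_formZ (lin i) (conj i)).
have := ler_wpM2l (normsq_ge0 a) (Mu i); have := Nv i; rewrite /df_sq.
by set x := Re _; set y := Re _; lra.
Qed.

HB.instance Definition _ := GRing.isSubmodClosed.Build R[i] V df_pred df_submod.

Definition df_space : Type := {v : V | v \in df_pred}.

HB.instance Definition _ := Choice.on df_space.
HB.instance Definition _ := SubType.on df_space.
HB.instance Definition _ := [SubChoice_isSubLmodule of df_space by <:].

Implicit Types x y z : df_space.

Lemma df_val_dom x : df_dom D (val x).
Proof. by have /df_predP[] := valP x. Qed.

Lemma df_valD x y : val (x + y) = val x + val y. Proof. by []. Qed.
Lemma df_valB x y : val (x - y) = val x - val y. Proof. by []. Qed.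
Lemma df_valZ a x : val (a *: x) = a *: val x. Proof. by []. Qed.

Definition df_Q (v : V) : R := sup (range (df_sq^~ v)).

Lemma df_has_sup v : df_bounded v -> has_sup (range (df_sq^~ v)).
Proof.
move=> [M Mv]; split; first by exists (df_sq (df_idx0 D) v); exists (df_idx0 D).
by exists M => _ [i _ <-].
Qed.

Lemma df_Q_ub v i : df_bounded v -> df_sq i v <= df_Q v.
Proof. by move=> bv; apply: sup_upper_bound; [exact: df_has_sup|exists i]. Qed.

Lemma df_Q_le v M : (forall i, df_sq i v <= M) -> df_Q v <= M.
Proof.
move=> Mv; apply: ge_sup; first by exists (df_sq (df_idx0 D) v); exists (df_idx0 D).
by move=> _ [i _ <-].
Qed.

(** Directedness merges the near-optimal indices of finitely many vectors into one. This is what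
    lets identities pass from the single forms to their supremum. *)
Lemma df_Q_approx (s : seq V) (e : R) : 0 < e ->
  (forall v, v \in s -> df_dom D v /\ df_bounded v) ->
  exists i, forall v, v \in s -> `|df_Q v - df_sq i v| <= e.
Proof.
move=> e0 sP.
suff [i iP] : exists i, forall v, v \in s -> df_Q v - e <= df_sq i v.
  exists i => v vs; have [_ bv] := sP v vs.
  by rewrite ger0_norm ?subr_ge0 ?df_Q_ub// lerBlDr addrC -lerBlDr iP.
elim: s sP => [|v s IH] sP; first by exists (df_idx0 D).
have [|i iP] := IH; first by move=> w ws; apply: sP; rewrite inE ws orbT.
have [dv bv] := sP v (mem_head _ _).
have [_ [j _ <-] jP] := sup_adherent e0 (df_has_sup bv).
have [k kP] := df_directed i j.
exists k => w; rewrite inE => /orP[/eqP ->|ws].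
  by have [_] := kP v dv; apply: le_trans; exact: ltW.
have [|dw _] := sP w; first by rewrite inE ws orbT.
by have [+ _] := kP w dw; apply: le_trans; exact: iP.
Qed.

(* The real part of the inner product, by polarization. *)
Definition df_r (x y : df_space) : R :=
  (df_Q (val (x + y)) - df_Q (val (x - y))) / 4.

Lemma df_r_approx (s : seq (df_space * df_space)) (e : R) : 0 < e ->
  exists i : df_idx D, forall p, p \in s ->
    `|df_r p.1 p.2 - Re (df_form i (val p.1) (val p.2))| <= e.
Proof.
move=> e0.
pose t := [seq val (p.1 + p.2) | p <- s] ++ [seq val (p.1 - p.2) | p <- s].
have [|i iP] := @df_Q_approx t e e0.
  by move=> v; rewrite mem_cat => /orP[] /mapP[p _ ->]; exact/df_predP/valP.
exists i => p ps.
have /iP : val (p.1 + p.2) \in t.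
  by rewrite mem_cat; apply/orP; left; apply/mapP; exists p.
have /iP : val (p.1 - p.2) \in t.
  by rewrite mem_cat; apply/orP; right; apply/mapP; exists p.
rewrite /df_r /df_sq df_valB df_valD (sq_formB (lin i) (conj i)) (sq_formD (lin i) (conj i)).
by rewrite !ler_norml => /andP[? ?] /andP[? ?]; apply/andP; split; lra.
Qed.

(* Being limits of the forms, the values of [df_r] inherit their linear relations. *)
Lemma df_r_ident (s : seq (R * (df_space * df_space))) :
  (forall i : df_idx D, \sum_(p <- s) p.1 * Re (df_form i (val p.2.1) (val p.2.2)) = 0) ->
  \sum_(p <- s) p.1 * df_r p.2.1 p.2.2 = 0.
Proof.
move=> s0; apply/eqP; rewrite -normr_eq0 eq_le normr_ge0 andbT.
apply/ler_addgt0Pl => e e0; rewrite addr0.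
pose S := 1 + \sum_(p <- s) `|p.1|.
have S0 : 0 < S by rewrite ltr_pwDl// sumr_ge0.
have [i iP] := df_r_approx [seq p.2 | p <- s] (divr_gt0 e0 S0).
have -> : \sum_(p <- s) p.1 * df_r p.2.1 p.2.2 =
    \sum_(p <- s) p.1 * (df_r p.2.1 p.2.2 - Re (df_form i (val p.2.1) (val p.2.2))).
  by under [RHS]eq_bigr do rewrite mulrBr; rewrite sumrB s0 subr0.
apply: le_trans (ler_norm_sum _ _ _) _.
apply: le_trans (_ : \sum_(p <- s) `|p.1| * (e / S) <= _); last first.
  rewrite -mulr_suml mulrCA ger_pMr// ler_pdivrMr// mul1r /S.
  by rewrite lerDr.
rewrite big_seq [leRHS]big_seq; apply: ler_sum => p ps.
by rewrite normrM ler_wpM2l// iP// map_f.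
Qed.

Lemma df_rDl x y z : df_r (x + y) z = df_r x z + df_r y z.
Proof.
have := @df_r_ident [:: (1, (x + y, z)); (-1, (x, z)); (-1, (y, z))].
rewrite !big_cons big_nil /= => H.
suff: 1 * df_r (x + y) z + (-1 * df_r x z + (-1 * df_r y z + 0)) = 0 by lra.
apply: H => i; rewrite !big_cons big_nil /= ?df_valD (formDl (lin i)) cReD; ring.
Qed.

Lemma df_rZl a x y :
  df_r (a *: x) y = Re a * df_r x y - Im a * df_r x ('i%C *: y).
Proof.
have := @df_r_ident [:: (1, (a *: x, y)); (- Re a, (x, y)); (Im a, (x, 'i%C *: y))].
rewrite !big_cons big_nil /= => H.
suff: 1 * df_r (a *: x) y + (- Re a * df_r x y + (Im a * df_r x ('i%C *: y) + 0)) = 0 by lra.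
apply: H => i; rewrite !big_cons big_nil /= ?df_valZ (formZl (lin i)) (formZr (lin i) (conj i)).
by rewrite !cReM cRe_conj cIm_conj /=; ring.
Qed.

Lemma df_rZr_i a x y : df_r (a *: x) ('i%C *: y) = Re a * df_r x ('i%C *: y) + Im a * df_r x y.
Proof.
have := @df_r_ident [:: (1, (a *: x, 'i%C *: y)); (- Re a, (x, 'i%C *: y)); (- Im a, (x, y))].
rewrite !big_cons big_nil /= => H.
suff: 1 * df_r (a *: x) ('i%C *: y) +
    (- Re a * df_r x ('i%C *: y) + (- Im a * df_r x y + 0)) = 0 by lra.
apply: H => i; rewrite !big_cons big_nil /= ?df_valZ (formZl (lin i)) (formZr (lin i) (conj i)).
by rewrite !cReM !cImM cRe_conj cIm_conj /=; ring.
Qed.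

Lemma df_rC x y : df_r y x = df_r x y.
Proof.
have := @df_r_ident [:: (1, (y, x)); (-1, (x, y))].
rewrite !big_cons big_nil /= => H.
suff: 1 * df_r y x + (-1 * df_r x y + 0) = 0 by lra.
apply: H => i; rewrite !big_cons big_nil /= (Re_formC (conj i) (val y)); ring.
Qed.

Lemma df_rC_i x y : df_r y ('i%C *: x) = - df_r x ('i%C *: y).
Proof.
have := @df_r_ident [:: (1, (y, 'i%C *: x)); (1, (x, 'i%C *: y))].
rewrite !big_cons big_nil /= => H.
suff: 1 * df_r y ('i%C *: x) + (1 * df_r x ('i%C *: y) + 0) = 0 by lra.
apply: H => i; rewrite !big_cons big_nil /= ?df_valZ !(formZr (lin i) (conj i)) (conj i (val x)).
by rewrite !cReM cRe_conj cIm_conj /= cRe_conj cIm_conj; ring.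
Qed.

(** The forms are conjugate-linear in the second argument, so the real part of <x, i y> is the
    imaginary part of <x, y>. *)
Definition df_dot (x y : df_space) : R[i] := df_r x y +i* df_r x ('i%C *: y).

Lemma df_dotDl x y z : df_dot (x + y) z = df_dot x z + df_dot y z.
Proof. by apply: complex_eqP; rewrite ?cReD ?cImD /= df_rDl. Qed.

Lemma df_dotZl a x y : df_dot (a *: x) y = a * df_dot x y.
Proof.
apply: complex_eqP; rewrite ?cReM ?cImM /=; first exact: df_rZl.
by rewrite df_rZr_i; ring.
Qed.

Lemma df_dotC x y : df_dot y x = Num.conj (df_dot x y).
Proof.
apply: complex_eqP; rewrite ?cRe_conj ?cIm_conj /=; first exact: df_rC.
exact: df_rC_i.
Qed.

Lemma df_dot_lin z a x y : df_dot (a *: x + y) z = a * df_dot x z + df_dot y z.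
Proof. by rewrite df_dotDl df_dotZl. Qed.

Lemma df_dotxx x : Re (df_dot x x) = df_Q (val x).
Proof.
apply/eqP; rewrite -subr_eq0 -normr_eq0 eq_le normr_ge0 andbT.
apply/ler_addgt0Pl => e e0; rewrite addr0.
have e2 : 0 < e / 2 by rewrite divr_gt0.
have sP v : v \in [:: val (x + x); val (x - x); val x] -> df_dom D v /\ df_bounded v.
  by rewrite !inE => /or3P[] /eqP ->; exact/df_predP/valP.
have [i iP] := df_Q_approx e2 sP.
have := iP (val (x + x)); have := iP (val (x - x)); have := iP (val x).
rewrite !inE !eqxx !orbT => /(_ isT) H1 /(_ isT) H2 /(_ isT) H3; move: H1 H2 H3.
rewrite /= /df_r /df_sq ?df_valD ?df_valB (sq_formB (lin i) (conj i)) (sq_formD (lin i) (conj i)).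
by rewrite !ler_norml => /andP[? ?] /andP[? ?] /andP[? ?]; apply/andP; split; lra.
Qed.

Lemma df_dot_ge0 x : 0 <= Re (df_dot x x).
Proof. 
rewrite df_dotxx; apply: le_trans (ge0 (df_idx0 D) (val x)) _.
by have /df_predP[_ b] := valP x; exact: (df_Q_ub (df_idx0 D) b).
Qed.

Lemma df_dot_eq0 x : Re (df_dot x x) = 0 -> x = 0.
Proof.
rewrite df_dotxx => Q0; apply: val_inj => /=; apply: (df_sep (df_val_dom x)) => i.
apply/eqP; rewrite eq_le ge0 andbT -Q0.
by have /df_predP[_ b] := valP x; exact: (df_Q_ub i b).
Qed.

Definition df_norm x : R[i] := (Num.sqrt (Re (df_dot x x)))%:C.

Lemma df_normD x y : df_norm (x + y) <= df_norm x + df_norm y.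
Proof.
rewrite /df_norm -rmorphD lecR.
exact: (sqrt_formD df_dot_lin df_dotC df_dot_ge0).
Qed.

Lemma df_normZ a x : df_norm (a *: x) = `|a| * df_norm x.
Proof.
rewrite /df_norm (sq_formZ df_dot_lin df_dotC) normc_def sqrtrM ?normsq_ge0//.
by rewrite rmorphM.
Qed.

Lemma df_norm0_eq0 x : df_norm x = 0 -> x = 0.
Proof.
move=> [/eqP]; rewrite sqrtr_eq0 => le0; apply: df_dot_eq0.
by apply/eqP; rewrite eq_le le0 df_dot_ge0.
Qed.

HB.instance Definition _ := @Lmodule_isNormed.Build R[i] df_space
  df_norm df_normD df_normZ df_norm0_eq0.

End DirectedForms.

Section DirectedFormsHilbert.
Variables (R : realType) (V : lmodType R[i]) (D : directed_forms V).
Local Notation H := (df_space D).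

Lemma df_normE (x : H) : `|x| = (Num.sqrt (Re (df_dot x x)))%:C.
Proof. by []. Qed.

(** [df_complete] gives convergence in each form separately. The Cauchy estimate is uniform over the
    forms, and sending one of its two indices to the limit gives a uniform estimate of the distance
    to [v]. *)
Lemma df_cauchy_seq (x : nat -> H) (t : nat -> R) :
  (forall e, 0 < e -> exists N, forall n, (N <= n)%N -> t n <= e) ->
  (forall m n, `|x m - x n| <= (t m + t n)%:C) ->
  exists v, forall e, 0 < e -> exists N, forall n, (N <= n)%N -> `|x n - v| <= e%:C.
Proof.
move=> t0 xC.
have xQ (e : R) : 0 < e -> exists N, forall m n, (N <= m)%N -> (N <= n)%N ->
    Re (df_dot (x m - x n) (x m - x n)) <= e.
  move=> e0; have se : 0 < Num.sqrt e by rewrite sqrtr_gt0.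
  have [N NP] := t0 (Num.sqrt e / 2) (divr_gt0 se (ltr0Sn _ _)).
  exists N => m n Nm Nn; have := xC m n; rewrite df_normE lecR => le1.
  have le2 : Num.sqrt (Re (df_dot (x m - x n) (x m - x n))) <= Num.sqrt e.
    by apply: le_trans le1 _; have := NP m Nm; have := NP n Nn; lra.
  by rewrite -ler_sqrt// ltW.
have [||v dv vP] := @df_complete _ _ D (fun n => val (x n)).
- by move=> n; exact: df_val_dom.
- move=> e e0; have [N NP] := xQ e e0; exists N => m n Nm Nn i.
  apply: le_trans (NP m n Nm Nn); rewrite df_dotxx.
  by have /df_predP[_ b] := valP (x m - x n); exact: (df_Q_ub i b).
have xv (e : R) : 0 < e -> exists N, forall n, (N <= n)%N -> forall i : df_idx D,
    df_sq i (val (x n) - v) <= e.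
  move=> e0; have [N NP] := xQ (e / 4) (divr_gt0 e0 (ltr0Sn _ _)).
  exists N => n Nn i; have [M MP] := vP i (e / 4) (divr_gt0 e0 (ltr0Sn _ _)).
  have {MP} := MP (maxn M N) (leq_maxl _ _).
  have {NP} := NP n (maxn M N) Nn (leq_maxr _ _).
  rewrite df_dotxx => Q1 Q2.
  have Q3 : df_sq i (val (x n) - val (x (maxn M N))) <= e / 4.
    apply: le_trans Q1; have /df_predP[_ b] := valP (x n - x (maxn M N)).
    exact: (df_Q_ub i b).
  have := sq_formD_le (@df_lin _ _ D i) (@df_conj _ _ D i) (@df_ge0 _ _ D i)
    (val (x n) - val (x (maxn M N))) (val (x (maxn M N)) - v).
  rewrite addrA subrK; move: Q2 Q3; rewrite /df_sq; lra.
have vH : v \in df_pred D.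
  apply/df_predP; split=> //; have [N NP] := xv 1 ltr01.
  have /df_predP[_ [M MP]] := valP (x N).
  exists (2 * (M + 1)) => i; have := NP N (leqnn _) i; have := MP i.
  have := sq_formD_le (@df_lin _ _ D i) (@df_conj _ _ D i) (@df_ge0 _ _ D i)
    (val (x N)) (- (val (x N) - v)).
  rewrite (sq_formN (@df_lin _ _ D i) (@df_conj _ _ D i)) opprB addrC subrK /df_sq; lra.
exists (Sub v vH) => e e0; have [N NP] := xv (e ^+ 2) (exprn_gt0 _ e0).
exists N => n Nn; rewrite df_normE lecR.
rewrite -[leRHS](ger0_norm (ltW e0)) -sqrtr_sqr ler_wsqrtr// df_dotxx.
apply: df_Q_le => i; rewrite df_valB SubK; exact: NP.
Qed.

Lemma df_cauchy_cvg (F : set_system H) : ProperFilter F -> cauchy F -> cvg F.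
Proof.
move=> FF /cauchy_ballP FC.
pose t n : R := n.+1%:R^-1.
have t0 n : 0 < t n by rewrite invr_gt0.
have tlim e : 0 < e -> exists N, forall n, (N <= n)%N -> t n <= e.
  exact: invS_eventually_le.
have FC2 : cauchy_ex F by apply/cauchyP/cauchy_ballP.
(* From filters to sequences: the centres of balls of radius [t n] that belong to [F] form a Cauchy
   sequence, since any two of these balls meet. *)
have /(_ _)/cid-/all_sig[x xP] : forall n, exists x, F (ball x (t n)%:C).
  by move=> n; apply: FC2; rewrite ltcR.
have [||v vP] := @df_cauchy_seq x t => //.
  move=> m n; have [z [/= zm zn]] := filter_ex (filterI (xP m) (xP n)).
  apply: le_trans (ler_distD z _ _) _; rewrite rmorphD.
  move: zm zn; rewrite -!ball_normE /= (distrC (x n) z) => a b.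
  exact: lerD (ltW a) (ltW b).
apply/cvg_ex; exists v; apply/cvg_ballP => e e0.
have [Im0 Re0] : Im e = 0 /\ 0 < Re e.
  by move: e0; rewrite ltcE /= => /andP[/eqP -> ->].
have eE : e = (Re e)%:C by apply: complex_eqP.
have e2 : 0 < Re e / 3 by rewrite divr_gt0.
have [N NP] := vP _ e2; have [M MP] := tlim _ e2.
apply: filterS (xP (maxn N M)) => z; rewrite -!ball_normE /= => xz.
have := NP _ (leq_maxl N M); have := MP _ (leq_maxr N M).
rewrite -lecR distrC => tM xN; apply: le_lt_trans (ler_distD (x (maxn N M)) _ _) _.
apply: le_lt_trans (lerD xN (ltW xz)) _.
rewrite -rmorphD /= eE ltcR; move: tM; rewrite lecR; lra.
Qed.

HB.instance Definition _ := Uniform_isComplete.Build H df_cauchy_cvg.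

Lemma df_dot_bilinear :
  bilinear_for *%R (Num.conj \; *%R) (@df_dot R V D : H -> H -> R[i]).
Proof.
split=> [v a x y|v a x y]; first exact: df_dot_lin.
rewrite (formDr (@df_dot_lin _ _ D) (@df_dotC _ _ D)).
by rewrite (formZr (@df_dot_lin _ _ D) (@df_dotC _ _ D)).
Qed.

HB.instance Definition _ := bilinear_isBilinear.Build R[i] H H R[i] *%R
  (Num.conj \; *%R) (@df_dot R V D : H -> H -> R[i]) df_dot_bilinear.

Lemma df_dot_herm (x y : H) : df_dot x y = (-1) ^+ false * Num.conj (df_dot y x).
Proof. by rewrite expr0 mul1r (df_dotC y x). Qed.

HB.instance Definition _ := isHermitianSesquilinear.Build R[i] H false
  Num.conj (@df_dot R V D : H -> H -> R[i]) df_dot_herm.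

Lemma df_dot_gt0 (x : H) : x != 0 -> 0 < df_dot x x.
Proof.
move=> x0; rewrite (form_real (@df_dotC _ _ D)) ltcR lt_def df_dot_ge0 andbT.
by apply: contra_neq x0 => /df_dot_eq0.
Qed.

HB.instance Definition _ := isDotProduct.Build R[i] H
  (@df_dot R V D : H -> H -> R[i]) df_dot_gt0.

Lemma df_normr_dot (x : H) : `|x| ^+ 2 = df_dot x x.
Proof.
by rewrite df_normE -rmorphXn/= sqr_sqrtr ?df_dot_ge0// [RHS](form_real (@df_dotC _ _ D)).
Qed.

HB.instance Definition _ := isHilbert.Build R H df_normr_dot.

End DirectedFormsHilbert.


(** * Calculus with the inner product and the squared norm *)

Section HilbertSpaces.
Variables (R : realType) (H : hilbertType R).
Implicit Types x y z : H.

Lemma dot_lin z a x y : dot (a *: x + y) z = a * dot x z + dot y z :> R[i].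
Proof. by rewrite linearPl. Qed.

Lemma dotC x y : dot y x = Num.conj (dot x y) :> R[i].
Proof. by rewrite hermC expr0 mul1r. Qed.

Definition nsq x : R := Re (dot x x).

Lemma nsq_ge0 x : 0 <= nsq x.
Proof.
have [->|x0] := eqVneq x 0; first by rewrite /nsq (form0l dot_lin).
have := @neq0_dnorm_gt0 _ _ _ dot x x0.
by rewrite /nsq ltcE /= => /andP[_ /ltW].
Qed.

Lemma nsq_gt0 x : x != 0 -> 0 < nsq x.
Proof.
move=> x0; have := @neq0_dnorm_gt0 _ _ _ dot x x0.
by rewrite /nsq ltcE /= => /andP[_].
Qed.

Lemma nsq_eq0 x : nsq x = 0 -> x = 0.
Proof. by move=> n0; apply: contraTeq isT => /nsq_gt0; rewrite n0 ltxx. Qed.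

Lemma nsq0 : nsq 0 = 0.
Proof. by rewrite /nsq (form0l dot_lin). Qed.

Lemma dotxx x : dot x x = (nsq x)%:C.
Proof. exact: (form_real dotC). Qed.

Lemma normr_nsq x : `|x| = (Num.sqrt (nsq x))%:C.
Proof.
apply/eqP; rewrite -(@eqrXn2 _ 2)// ?normr_dot ?dotxx.
  by rewrite -rmorphXn/= sqr_sqrtr// nsq_ge0.
by rewrite ler0c sqrtr_ge0.
Qed.

Lemma dotDl x y z : dot (x + y) z = dot x z + dot y z :> R[i].
Proof. exact: (formDl dot_lin). Qed.

Lemma dotBl x y z : dot (x - y) z = dot x z - dot y z :> R[i].
Proof. exact: (formBl dot_lin). Qed.

Lemma dotZl a x z : dot (a *: x) z = a * dot x z :> R[i].
Proof. exact: (formZl dot_lin). Qed.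

Lemma dotNl x z : dot (- x) z = - dot x z :> R[i].
Proof. exact: (formNl dot_lin). Qed.

Lemma dot0l z : dot 0 z = 0 :> R[i].
Proof. exact: (form0l dot_lin). Qed.

Lemma dotDr x y z : dot z (x + y) = dot z x + dot z y :> R[i].
Proof. exact: (formDr dot_lin dotC). Qed.

Lemma dotBr x y z : dot z (x - y) = dot z x - dot z y :> R[i].
Proof. exact: (formBr dot_lin dotC). Qed.

Lemma dotZr a x z : dot z (a *: x) = Num.conj a * dot z x :> R[i].
Proof. exact: (formZr dot_lin dotC). Qed.

Lemma dotNr x z : dot z (- x) = - dot z x :> R[i].
Proof. exact: (formNr dot_lin dotC). Qed.

Lemma dot_suml (I : Type) (r : seq I) (P : pred I) (f : I -> H) z :
  dot (\sum_(i <- r | P i) f i) z = \sum_(i <- r | P i) dot (f i) z :> R[i].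
Proof. exact: (form_suml dot_lin). Qed.

Lemma dot_sumr (I : Type) (r : seq I) (P : pred I) (f : I -> H) z :
  dot z (\sum_(i <- r | P i) f i) = \sum_(i <- r | P i) dot z (f i) :> R[i].
Proof. exact: (form_sumr dot_lin dotC). Qed.

Lemma nsqD x y : nsq (x + y) = nsq x + nsq y + 2 * Re (dot x y).
Proof. exact: (sq_formD dot_lin dotC). Qed.

Lemma nsqN x : nsq (- x) = nsq x.
Proof. exact: (sq_formN dot_lin dotC). Qed.

Lemma nsqBC x y : nsq (x - y) = nsq (y - x).
Proof. by rewrite -nsqN opprB. Qed.

Lemma nsqZ a x : nsq (a *: x) = normsq a * nsq x.
Proof. exact: (sq_formZ dot_lin dotC). Qed.

Lemma nsqD_le x y : nsq (x + y) <= 2 * (nsq x + nsq y).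
Proof. exact: (sq_formD_le dot_lin dotC nsq_ge0). Qed.

Lemma dot_cauchy_schwarz x y : normsq (dot x y) <= nsq x * nsq y.
Proof. exact: (cauchy_schwarz dot_lin dotC nsq_ge0). Qed.

Lemma nsq_cauchy_cvg (x : nat -> H) :
  (forall e : R, 0 < e -> exists N, forall m n, (N <= m)%N -> (N <= n)%N ->
    nsq (x m - x n) <= e) ->
  exists v, forall e : R, 0 < e -> exists N, forall n, (N <= n)%N -> nsq (x n - v) <= e.
Proof.
move=> xC.
have normlt z (e : R) : 0 < e -> nsq z < e ^+ 2 -> `|z| < e%:C.
  move=> e0 ze; rewrite normr_nsq ltcR -(ger0_norm (ltW e0)) -sqrtr_sqr ltr_sqrt//.
  by rewrite exprn_gt0.
have : cvg (x @ \oo).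
  apply: cauchy_cvg; apply/cauchy_ballP => e e0.
  have [Im0 Re0] : Im e = 0 /\ 0 < Re e by move: e0; rewrite ltcE /= => /andP[/eqP -> ->].
  have eE : e = (Re e)%:C by apply: complex_eqP.
  have [N NP] := xC (Re e ^+ 2 / 2) (divr_gt0 (exprn_gt0 _ Re0) (ltr0Sn _ _)).
  exists ([set z | exists2 m, (N <= m)%N & z = x m],
          [set z | exists2 m, (N <= m)%N & z = x m]) => /=.
    by split; exists N => // m /= Nm; exists m.
  move=> [y z] /= [[m Nm ->] [n Nn ->]]; rewrite -ball_normE /= eE; apply: normlt => //.
  apply: le_lt_trans (NP m n Nm Nn) _; rewrite ltr_pdivrMr// ltr_pMr ?ltr1n//.
  by rewrite exprn_gt0.
move=> /cvg_ex[v xv]; exists v => e e0.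
have se : 0 < (Num.sqrt e)%:C by rewrite ltcR sqrtr_gt0.
have /cvgrPdist_lt/(_ _ se)[N _ NP] := xv.
exists N => n Nn; have := NP n Nn; rewrite /= normr_nsq ltcR ltr_sqrt// nsqBC.
exact: ltW.
Qed.

End HilbertSpaces.

(** * Projections and orthonormal lists *)

Section Minimization.
Variables (R : realType) (H : hilbertType R) (a : H -> H -> R[i]).
Hypothesis a_lin : forall w c u v, a (c *: u + v) w = c * a u w + a v w.
Hypothesis a_conj : forall u v, a v u = Num.conj (a u v).
Hypothesis a_ge0 : forall v, 0 <= Re (a v v).
Variables (B c : R) (Z : H -> Prop).
Hypothesis a_bound : forall v, Re (a v v) <= B * nsq v.
Hypothesis Z0 : Z 0.
Hypothesis ZP : forall t u v, Z u -> Z v -> Z (t *: u + v).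
Hypothesis Z_closed : forall (z : nat -> H) v, (forall n, Z (z n)) ->
  (forall e : R, 0 < e -> exists N, forall n, (N <= n)%N -> nsq (z n - v) <= e) -> Z v.
Hypothesis c_gt0 : 0 < c.
Hypothesis a_coercive : forall z, Z z -> c * nsq z <= Re (a z z).

Local Notation q v := (Re (a v v)).

(** Moving [u] by the best multiple of [z] lowers [q u] by [normsq (a u z) / q z], and a
    near-minimum leaves room for at most [eta]. *)
Lemma near_min_orthogonal u z (m eta : R) : Z z ->
  (forall z', Z z' -> m <= q (u + z')) -> q u <= m + eta ->
  normsq (a u z) <= eta * q z.
Proof.
move=> Zz mP uP; have [qz0|qz0] := eqVneq (q z) 0.
  by rewrite (form_eq0 a_lin a_conj a_ge0 u qz0) qz0 mulr0 /normsq /= expr0n addr0.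
have qz : 0 < q z by rewrite lt_def qz0 a_ge0.
pose s : R := (q z)^-1; pose w := a u z.
have := mP ((- (s%:C * w)) *: z).
rewrite -[_ *: z]addr0 => /(_ (ZP _ Zz Z0)); rewrite addr0.
rewrite (sq_formD a_lin a_conj) (sq_formZ a_lin a_conj) (formZr a_lin a_conj) -/w.
have -> : normsq (- (s%:C * w)) * q z = s * normsq w.
  by rewrite /normsq cReN cImN cReM cImM /= /s; field.
have -> : Re (Num.conj (- (s%:C * w)) * w) = - (s * normsq w).
  by rewrite cReM cRe_conj cIm_conj cReN cImN cReM cImM /= /normsq; ring.
move=> le1; have le2 : s * normsq w <= eta by lra.
by move: le2; rewrite /s mulrC ler_pdivrMr.
Qed.

(** By the parallelogram law and coercivity a minimizing sequence is Cauchy for [nsq]; [a_bound]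
    then carries its near-orthogonality to the limit. The form is kept general because it is [dot]
    for projections and [defect] for the eigenvalue problem. *)
Lemma exists_minimizer v : exists2 z, Z z & forall z', Z z' -> a (v + z) z' = 0.
Proof.
pose E := [set q (v + z) | z in [set z | Z z]].
have hasE : has_inf E.
  split; first by exists (q (v + 0)); exists 0.
  by exists 0 => _ [z _ <-].
pose m := inf E.
have mP z : Z z -> m <= q (v + z) by move=> Zz; apply: inf_lbound; [case: hasE|exists z].
pose t n : R := n.+1%:R^-1.
have t0 n : 0 < t n by rewrite invr_gt0.
have tlim e : 0 < e -> exists N, forall n, (N <= n)%N -> t n <= e.
  exact: invS_eventually_le.
have /(_ _)/cid-/all_sig[z zP] : forall n, exists z, Z z /\ q (v + z) <= m + t n.
  move=> n; have [_ [z Zz <-] zlt] := inf_adherent (t0 n) hasE.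
  by exists z; split=> //; exact: ltW.
have Zz n : Z (z n) by have [] := zP n.
have zm n : q (v + z n) <= m + t n by have [] := zP n.
have zC (e : R) : 0 < e -> exists N, forall j k, (N <= j)%N -> (N <= k)%N ->
    nsq (z j - z k) <= e.
  (* The parallelogram law bounds [q (z j - z k)] by [2 * (t j + t k)], hence by [c * e] with this
     choice. *)
  move=> e0; have [|N NP] := tlim (c * e / 4); first by rewrite divr_gt0// mulr_gt0.
  exists N => j k Nj Nk.
  have Zd : Z (z j - z k) by rewrite addrC -scaleN1r; exact: ZP.
  have Zmid : Z (2^-1 *: (z j + z k)).
    by rewrite -[_ *: _]addr0; apply: ZP => //; rewrite -[z j]scale1r; exact: ZP.
  have := parallelogram a_lin a_conj (v + z j) (v + z k).
  have -> : v + z j - (v + z k) = z j - z k by rewrite opprD addrACA subrr add0r.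
  have -> : v + z j + (v + z k) = (2 : R[i]) *: (v + 2^-1 *: (z j + z k)).
    rewrite scalerDr scalerA divff ?pnatr_eq0// scale1r addrACA.
    by rewrite scaler_nat mulr2n.
  rewrite (sq_formZ a_lin a_conj).
  have -> : normsq (2 : R[i]) = 4 by rewrite /normsq /=; ring.
  have := mP _ Zmid; have := zm j; have := zm k; have := NP j Nj; have := NP k Nk.
  have := a_coercive Zd => H1 H2 H3 H4 H5 H6 H7.
  by rewrite -(ler_pM2l c_gt0); lra.
have [w wP] := nsq_cauchy_cvg zC.
exists w; first exact: Z_closed Zz wP.
move=> z' Zz'; apply: normsq_eq0; apply/eqP; rewrite eq_le normsq_ge0 andbT.
have qz' := a_ge0 z'.
have B0 : 0 <= B * nsq z' by apply: le_trans (a_bound z').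
apply/ler_addgt0Pl => e e0; rewrite addr0.
(* The errors from near-minimality and from the distance to the limit add up to
   [e / K * (2 * q z' * (1 + |B|))]; the summand 1 keeps [K] positive. *)
pose K := 2 * q z' * (1 + `|B|) + 1.
have K0 : 0 < K by rewrite ltr_wpDl// mulr_ge0// ?mulr_ge0// addr_ge0.
have eK : 0 < e / K by rewrite divr_gt0.
have [N NP] := tlim _ eK; have [M MP] := wP _ eK.
pose n := maxn N M.
have tn := NP n (leq_maxl _ _); have wn := MP n (leq_maxr _ _).
have le1 : normsq (a (v + z n) z') <= t n * q z'.
  apply: (@near_min_orthogonal _ _ m) => // z2 Zz2; rewrite -addrA; apply: mP.
  by rewrite -[z n]scale1r; apply: ZP.
have le2 := cauchy_schwarz a_lin a_conj a_ge0 (w - z n) z'.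
have le3 : q (w - z n) <= `|B| * (e / K).
  apply: le_trans (a_bound _) _; apply: le_trans (_ : `|B| * nsq (w - z n) <= _).
    by rewrite ler_wpM2r ?nsq_ge0// ler_norm.
  by rewrite ler_wpM2l// nsqBC.
have -> : v + w = (v + z n) + (w - z n) by rewrite addrACA subrr addr0 addrC.
rewrite (formDl a_lin); set x := a _ _; set y := a _ _.
have le4 : normsq (x + y) <= 2 * (normsq x + normsq y).
  rewrite /normsq cReD cImD; have := sqr_ge0 (Re x - Re y); have := sqr_ge0 (Im x - Im y).
  by nra.
apply: le_trans le4 _.
have le5 : normsq x <= e / K * q z' by apply: le_trans le1 _; rewrite ler_wpM2r.
have le6 : normsq y <= `|B| * (e / K) * q z'.
  by apply: le_trans le2 _; rewrite ler_wpM2r.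
apply: le_trans (_ : e / K * (2 * q z' * (1 + `|B|)) <= _); first by lra.
by rewrite mulrAC ler_pdivrMr// (ler_wpM2l (ltW e0))// /K lerDl.
Qed.

End Minimization.

Section Projection.
Variables (R : realType) (H : hilbertType R) (Z : H -> Prop).
Hypothesis Z0 : Z 0.
Hypothesis ZP : forall t u v, Z u -> Z v -> Z (t *: u + v).
Hypothesis Z_closed : forall (z : nat -> H) v, (forall n, Z (z n)) ->
  (forall e : R, 0 < e -> exists N, forall n, (N <= n)%N -> nsq (z n - v) <= e) -> Z v.

Lemma projection_theorem v :
  exists2 z, Z z & forall z', Z z' -> dot (v - z) z' = 0 :> R[i].
Proof.
have [||z Zz zP] := @exists_minimizer _ _ (@dot R H) (@dot_lin R H) (@dotC R H)
  (@nsq_ge0 R H) 1 1 Z _ Z0 ZP Z_closed ltr01 _ v.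
- by move=> x; rewrite mul1r.
- by move=> x _; rewrite mul1r.
exists (- z); last by move=> z'; rewrite opprK; exact: zP.
by rewrite -scaleN1r -[_ *: z]addr0; apply: ZP.
Qed.

End Projection.

(** * Orthonormal lists and finite rank operators *)

Section OrthonormalLists.
Variables (R : realType) (H : hilbertType R).
Implicit Types (x y z : H) (s r : seq H) (L : seq (H * H)).

Fixpoint ons s : Prop :=
  if s is x :: s' then
    [/\ nsq x = 1, forall y, y \in s' -> dot x y = 0 :> R[i] & ons s']
  else True.

Definition proj s x : H := \sum_(f <- s) dot x f *: f.

Lemma ons_nsq s x : ons s -> x \in s -> nsq x = 1.
Proof.
by elim: s => [//|y s IH] /= [y1 _ os]; rewrite inE => /orP[/eqP ->//|/IH]; apply.
Qed.

Lemma dot_proj_mem s x f : ons s -> f \in s -> dot (proj s x) f = dot x f.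
Proof.
rewrite /proj; elim: s => [//|y s IH] /= [y1 ys os].
rewrite big_cons dotDl dotZl inE => /predU1P[->|fs].
  rewrite dotxx y1 mulr1 dot_suml big_seq big1 ?addr0// => z zs.
  by rewrite dotZl (dotC y z) ys// rmorph0 mulr0.
by rewrite ys// mulr0 add0r IH.
Qed.

Lemma dot_proj_eq s x f : dot x (proj s f) = \sum_(e <- s) dot x e * Num.conj (dot f e).
Proof. by rewrite /proj dot_sumr; apply: eq_bigr => e _; rewrite dotZr mulrC. Qed.

Lemma dot_sub_proj s x f : ons s -> f \in s -> dot (x - proj s x) f = 0.
Proof. by move=> os fs; rewrite dotBl (dot_proj_mem _ os fs) subrr. Qed.

Lemma dot_residual s x y : ons s ->
  dot (x - proj s x) (y - proj s y) = dot x y - \sum_(f <- s) dot x f * dot f y.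
Proof.
move=> os; rewrite dotBr [X in _ - X](_ : _ = 0); last first.
  rewrite dot_proj_eq big_seq big1// => e es.
  by rewrite dot_sub_proj// mul0r.
rewrite subr0 dotBl; congr (_ - _).
by rewrite /proj dot_suml; apply: eq_bigr => f _; rewrite dotZl.
Qed.

Lemma bessel s x : ons s -> \sum_(f <- s) normsq (dot x f) <= nsq x.
Proof.
move=> os; have := nsq_ge0 (x - proj s x).
rewrite {1}/nsq dot_residual// cReD cReN cRe_sum subr_ge0.
under eq_bigr => f _ do rewrite (dotC x f) mul_conj_normsq.
by [].
Qed.

Lemma proj_mem s x : ons s -> x \in s -> proj s x = x.
Proof.
move=> os xs; rewrite /proj; elim: s os xs => [//|y s IH] /= [y1 ys os].
rewrite big_cons inE => /predU1P[->|xs].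
  rewrite dotxx y1 scale1r big_seq big1 ?addr0// => z zs.
  by rewrite ys// scale0r.
by rewrite (dotC y x) ys// rmorph0 scale0r add0r IH.
Qed.

Lemma proj_catr s r x : ons (s ++ r) -> proj r x = x -> proj (s ++ r) x = x.
Proof.
elim: s => [//|y s IH] /= [y1 ys os] px.
rewrite /proj big_cons -/(proj _ _) IH// -px /proj dot_suml big_seq big1 ?scale0r ?add0r// => f fr.
by rewrite dotZl (dotC y f) ys ?rmorph0 ?mulr0// mem_cat fr orbT.
Qed.

(** The list [s] survives unchanged as a tail, so sums of squares over [t ++ s] dominate those over
    [s]; [hs_directed] rests on this. *)
Lemma gram_schmidt s r : ons s ->
  exists2 t, ons (t ++ s) & forall x, x \in r -> proj (t ++ s) x = x.
Proof.
move=> os; elim: r => [|x r [t ot tP]]; first by exists [::].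
have [y0|y0] := eqVneq (x - proj (t ++ s) x) 0.
  exists t => // z; rewrite inE => /predU1P[->|/tP//].
  by apply/esym/eqP; rewrite -subr_eq0 y0.
set y := x - _ in y0.
pose a := (Num.sqrt (nsq y))^-1; pose u := a%:C *: y.
have yp : 0 < nsq y by exact: nsq_gt0.
have oy f : f \in t ++ s -> dot y f = 0 by exact: dot_sub_proj.
have ou : ons (u :: t ++ s).
  split=> //; last by move=> f fs; rewrite dotZl oy// mulr0.
  by rewrite nsqZ /normsq /= expr0n addr0 /a exprVn sqr_sqrtr ?ltW// mulVf// gt_eqF.
exists (u :: t) => // z; rewrite inE => /predU1P[->|/tP zP]; last first.
  exact: (@proj_catr [:: u] (t ++ s)).
rewrite /= /proj big_cons -/(proj _ _).
have -> : dot x u *: u = y; last by rewrite subrK.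
have -> : dot x u = dot y u.
  rewrite -[x in LHS](subrK (proj (t ++ s) x)) dotDl -/y.
  rewrite [X in _ + X](_ : _ = 0) ?addr0// dot_suml big_seq big1// => f fs.
  by rewrite dotZl (dotC u f) /u dotZl oy// mulr0 rmorph0 mulr0.
rewrite /u dotZr scalerA dotxx -[RHS]scale1r; congr (_ *: _).
apply: complex_eqP; rewrite !(cReM, cImM, cRe_conj, cIm_conj) /=; last by ring.
rewrite oppr0 !mulr0 !subr0 mulrAC -expr2 /a exprVn sqr_sqrtr ?ltW// mulVf// gt_eqF//.
Qed.

(* The squared Hilbert-Schmidt norm of the finite rank operator
   [x |-> \sum_(p <- L) dot x p.2 *: p.1]. *)
Definition fr_sq L : R :=
  Re (\sum_(p <- L) \sum_(p' <- L) dot p.1 p'.1 * dot p'.2 p.2).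

(* Schur product theorem: expand each [dot p'.2 p.2] in an orthonormal basis
   of the span of the second components. *)
Lemma fr_sq_ge0 L : 0 <= fr_sq L.
Proof.
have [t ot tP] := @gram_schmidt [::] [seq p.2 | p <- L] I.
rewrite cats0 in ot tP.
have -> : fr_sq L = \sum_(f <- t) nsq (\sum_(p <- L) Num.conj (dot p.2 f) *: p.1).
  rewrite /nsq -cRe_sum /fr_sq; congr (complex.Re _).
  under [RHS]eq_bigr => f _ do rewrite dot_suml.
  rewrite [RHS]exchange_big /=; apply: eq_bigr => p _.
  under [RHS]eq_bigr => f _ do rewrite dot_sumr.
  rewrite [RHS]exchange_big /= big_seq [RHS]big_seq; apply: eq_bigr => p' p'L.
  have -> : dot p'.2 p.2 = \sum_(f <- t) dot p'.2 f * dot f p.2.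
    rewrite -{1}(tP p'.2) ?map_f// /proj dot_suml.
    by apply: eq_bigr => f _; rewrite dotZl.
  rewrite mulr_sumr; apply: eq_bigr => f _.
  by rewrite dotZl dotZr conjCK (dotC p.2 f); ring.
by apply: sumr_ge0 => f _; exact: nsq_ge0.
Qed.

(** Bessel's inequality for the finite rank operator of [L]: projecting its second components off
    [s] composes it with the projection onto the complement of [s], and the squared norm of the
    result, which is nonnegative, is the difference of the two sides. *)
Lemma fr_sq_bound s L : ons s ->
  \sum_(f <- s) nsq (\sum_(p <- L) dot f p.2 *: p.1) <= fr_sq L.
Proof.
move=> os.
have := fr_sq_ge0 [seq (p.1, p.2 - proj s p.2) | p <- L].
suff -> : fr_sq [seq (p.1, p.2 - proj s p.2) | p <- L] =
   fr_sq L - \sum_(f <- s) nsq (\sum_(p <- L) dot f p.2 *: p.1) by rewrite subr_ge0.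
rewrite /fr_sq /nsq -cRe_sum -cReN -cReD; congr (complex.Re _).
rewrite big_map; under eq_bigr => p _ do rewrite big_map.
under [X in _ = _ - X]eq_bigr => f _ do rewrite dot_suml.
rewrite [X in _ = _ - X]exchange_big -sumrB; apply: eq_bigr => p _ /=.
under [X in _ = _ - X]eq_bigr => f _ do rewrite dot_sumr.
rewrite [X in _ = _ - X]exchange_big -sumrB; apply: eq_bigr => p' _ /=.
rewrite dot_residual// mulrBr mulr_sumr; congr (_ - _); apply: eq_bigr => f _.
by rewrite dotZl dotZr (dotC f p'.2); ring.
Qed.

End OrthonormalLists.

(** * Property (T) in Hilbert spaces of directed forms *)

Section PropertyT.
Variable R : realType.

Lemma nsq_preserving_dot (H K : hilbertType R) (f : H -> K) :
  linear f -> (forall x, nsq (f x) = nsq x) -> dot_preserving f.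
Proof.
move=> fl fn x y.
have fRe u v : Re (dot (f u) (f v)) = Re (dot u v).
  have := fn (u + v); have -> : f (u + v) = f u + f v.
    by have := fl 1 u v; rewrite !scale1r.
  by rewrite !nsqD !fn; lra.
apply: complex_eqP; first exact: fRe.
have := fRe x ('i%C *: y).
have -> : f ('i%C *: y) = 'i%C *: f y.
  have f0 : f 0 = 0.
    have := fl 1 0 0; rewrite scale1r addr0 => /eqP.
    by rewrite scale1r -subr_eq0 opprD addrA subrr sub0r oppr_eq0 => /eqP.
  by have := fl 'i%C y 0; rewrite f0 !addr0.
by rewrite !dotZr !cReM !cRe_conj !cIm_conj /=; lra.
Qed.

Variables (G : groupType) (F : {fset G}) (eps : R).
Hypothesis kazhdan : forall (H : hilbertType R) (rho : G -> H -> H),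
  unitary_rep rho ->
  (exists2 x : H, x != 0 &
     forall g, g \in F -> `|rho g x - x| < eps%:C * `|x|) ->
  exists2 y : H, y != 0 & forall g, rho g y = y.
Hypothesis eps_gt0 : 0 < eps.

Variables (V : lmodType R[i]) (D : directed_forms V) (A : G -> V -> V).
Hypothesis A_lin : forall g a u v, A g (a *: u + v) = a *: A g u + A g v.
Hypothesis A_dom : forall g v, df_dom D v -> df_dom D (A g v).
Hypothesis A_idx : forall g (i : df_idx D), exists j : df_idx D,
  forall v, df_dom D v -> df_sq i (A g v) <= df_sq j v.
Hypothesis A_mul : forall g h v, df_dom D v -> A (g * h)%g v = A g (A h v).
Hypothesis A_1 : forall v, df_dom D v -> A 1%g v = v.

(** Property (T) phrased in the forms alone, so that no supremum has to be computed: one form bounds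
    the norm of [v] from below, and a bound common to all forms controls its displacement. *)
Lemma kazhdan_invariant_vector (v : V) (i : df_idx D) (m M : R) :
  df_dom D v -> df_bounded D v -> 0 < m -> m <= df_sq i v ->
  M < eps ^+ 2 * m ->
  (forall g, g \in F -> forall j : df_idx D, df_sq j (A g v - v) <= M) ->
  exists w, [/\ df_dom D w, df_bounded D w, w != 0 & forall g, A g w = w].
Proof.
move=> dv bv m0 mv Mm MP.
pose H : hilbertType R := df_space D.
have AP g (x : H) : A g (val x) \in df_pred D.
  have /df_predP[dx [C CP]] := valP x; apply/df_predP; split; first exact: A_dom.
  exists C => j; have [k kP] := A_idx g j.
  by apply: le_trans (kP _ dx) _.
pose rho g (x : H) : H := Sub (A g (val x)) (AP g x).
have rhoE g x : val (rho g x) = A g (val x) by [].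
have rho_lin g : linear (rho g).
  by move=> a x y; apply: val_inj; rewrite rhoE /= A_lin.
have rhoM g h x : rho (g * h)%g x = rho g (rho h x).
  by apply: val_inj; rewrite !rhoE A_mul//; exact: df_val_dom.
have rho1 x : rho 1%g x = x.
  by apply: val_inj; rewrite !rhoE A_1//; exact: df_val_dom.
have nsqE (x : H) : nsq x = df_Q D (val x) by exact: df_dotxx.
have rho_le g x : nsq (rho g x) <= nsq x.
  rewrite !nsqE; apply: df_Q_le => j; have [k kP] := A_idx g j.
  have /df_predP[dx bx] := valP x.
  exact: le_trans (kP _ dx) (df_Q_ub k bx).
(* [A_idx] only makes each [rho g] contractive; contractivity of the inverse gives equality. *)
have rho_nsq g x : nsq (rho g x) = nsq x.
  apply/eqP; rewrite eq_le rho_le /=.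
  by have := rho_le (g^-1)%g (rho g x); rewrite -rhoM mulVg rho1.
have rho_rep : unitary_rep rho.
  split; last by move=> g h; apply/funext => x; exact: rhoM.
  move=> g; split => //; first exact: nsq_preserving_dot.
  by move=> y; exists (rho (g^-1)%g y); rewrite -rhoM mulgV rho1.
have vP : v \in df_pred D by apply/df_predP.
pose x : H := Sub v vP.
have mx : m <= nsq x.
  by rewrite nsqE; apply: le_trans mv _; exact: (df_Q_ub i bv).
have x0 : x != 0.
  by apply: contraTneq (lt_le_trans m0 mx) => ->; rewrite nsq0 ltxx.
have [|y y0 yP] := kazhdan rho_rep.
  exists x => // g gF; rewrite !normr_nsq -rmorphM ltcR.
  have -> : eps * Num.sqrt (nsq x) = Num.sqrt (eps ^+ 2 * nsq x).
    by rewrite [RHS]sqrtrM ?sqr_ge0// sqrtr_sqr ger0_norm// ltW.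
  have e2 : 0 < eps ^+ 2 by rewrite exprn_gt0.
  rewrite ltr_sqrt; last by rewrite mulr_gt0// (lt_le_trans m0 mx).
  apply: le_lt_trans (_ : M < _); last first.
    by apply: lt_le_trans Mm _; rewrite ler_pM2l.
  by rewrite nsqE; apply: df_Q_le => j; rewrite df_valB; exact: MP.
exists (val y); have /df_predP[dy bY] := valP y; split=> //.
by move=> g; rewrite -rhoE yP.
Qed.

End PropertyT.

(** * Hilbert-Schmidt operators *)

Section HilbertSchmidt.
Variables (R : realType) (K : hilbertType R).
Implicit Types (T S : K -> K) (s r : seq K).

Lemma linear_mapD T (Tl : linear T) x y : T (x + y) = T x + T y.
Proof. by have := Tl 1 x y; rewrite !scale1r. Qed.

Lemma linear_map0 T (Tl : linear T) : T 0 = 0.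
Proof.
by apply: (addIr (T 0)); rewrite -(linear_mapD Tl) !add0r.
Qed.

Lemma linear_mapZ T (Tl : linear T) a x : T (a *: x) = a *: T x.
Proof. by have := Tl a x 0; rewrite (linear_map0 Tl) !addr0. Qed.

Lemma linear_mapN T (Tl : linear T) x : T (- x) = - T x.
Proof. by rewrite -scaleN1r (linear_mapZ Tl) scaleN1r. Qed.

Lemma linear_mapB T (Tl : linear T) x y : T (x - y) = T x - T y.
Proof. by rewrite (linear_mapD Tl) (linear_mapN Tl). Qed.

Lemma linear_map_sum T (Tl : linear T) (I : Type) (r : seq I) (P : pred I) (F : I -> K) :
  T (\sum_(i <- r | P i) F i) = \sum_(i <- r | P i) T (F i).
Proof.
by apply: (big_morph T); [exact: linear_mapD|exact: linear_map0].
Qed.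

Lemma normalize (x : K) : x != 0 ->
  exists2 u, nsq u = 1 & x = (Num.sqrt (nsq x))%:C *: u.
Proof.
move=> /nsq_gt0 x0; exists ((Num.sqrt (nsq x))^-1%:C *: x).
  by rewrite nsqZ /normsq /= expr0n addr0 exprVn sqr_sqrtr ?ltW// mulVf// gt_eqF.
by rewrite scalerA -rmorphM mulfV ?scale1r// gt_eqF// sqrtr_gt0.
Qed.

Lemma unit_bound_scale T (e : R) x : linear T ->
  (forall u, nsq u = 1 -> nsq (T u) <= e) -> nsq (T x) <= e * nsq x.
Proof.
move=> Tl Te; have [->|/[dup] x0 /normalize[u u1 xu]] := eqVneq x 0.
  by rewrite (linear_map0 Tl) nsq0 mulr0.
rewrite [in leLHS]xu (linear_mapZ Tl) nsqZ /normsq /= expr0n addr0 sqr_sqrtr ?nsq_ge0//.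
by rewrite mulrC ler_wpM2r ?nsq_ge0 ?Te.
Qed.

Definition hs_sq s T : R := \sum_(f <- s) nsq (T f).

Lemma hs_sq_cat s r T : hs_sq (s ++ r) T = hs_sq s T + hs_sq r T.
Proof. by rewrite /hs_sq big_cat. Qed.

Lemma hs_sq_ge0 s T : 0 <= hs_sq s T.
Proof. by apply: sumr_ge0 => f _; exact: nsq_ge0. Qed.

(** The pairs [(T b, b)] with [b] in [s] describe [T] composed with the projection onto the span of
    [s]. This finite rank operator agrees with [T] on [r], so [fr_sq_bound] applies. *)
Lemma hs_sq_span s r T : linear T -> ons s -> ons r ->
  (forall x, x \in r -> proj s x = x) -> hs_sq r T <= hs_sq s T.
Proof.
move=> Tl os or rs; have := fr_sq_bound [seq (T b, b) | b <- s] or.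
have -> : fr_sq [seq (T b, b) | b <- s] = hs_sq s T.
  rewrite /fr_sq big_map /hs_sq /nsq -cRe_sum; congr (complex.Re _).
  rewrite big_seq [RHS]big_seq; apply: eq_bigr => b bs; rewrite big_map /=.
  rewrite -[in X in _ = dot _ X](proj_mem os bs) /proj (linear_map_sum Tl) dot_sumr.
  apply: eq_bigr => c _; rewrite (linear_mapZ Tl) dotZr (dotC b c).
  by rewrite mulrC.
apply: le_trans; rewrite /hs_sq big_seq [leRHS]big_seq; apply: ler_sum => f fr.
rewrite -[in leLHS](rs f fr) /proj (linear_map_sum Tl) big_map.
rewrite le_eqVlt; apply/orP; left; apply/eqP; congr nsq.
by apply: eq_bigr => b _; exact: linear_mapZ.
Qed.

Variable W : K -> Prop.

(** Vanishing on [W] is part of the domain, so that an invariant operator obtained from property (T)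
    vanishes there too. *)
Definition hs_dom T : Prop := linear T /\ forall x, W x -> T x = 0.

Definition hs_form (i : {s : seq K | ons s}) T S : R[i] :=
  \sum_(f <- sval i) dot (T f) (S f).

Lemma hs_formE i T : Re (hs_form i T T) = hs_sq (sval i) T.
Proof. by rewrite /hs_form cRe_sum. Qed.

Lemma hs_dom0 : hs_dom 0.
Proof. by split=> // a x y; change (0 = a *: 0 + 0 :> K); rewrite scaler0 addr0. Qed.

Lemma hs_domP a T S : hs_dom T -> hs_dom S -> hs_dom (a *: T + S).
Proof.
move=> [Tl TW] [Sl SW]; split=> [b x y|x Wx].
  change (a *: T (b *: x + y) + S (b *: x + y) = b *: (a *: T x + S x) + (a *: T y + S y)).
  rewrite Tl Sl !scalerDr !scalerA [b * a]mulrC.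
  by rewrite addrACA.
by change (a *: T x + S x = 0); rewrite TW// SW// scaler0 addr0.
Qed.

Lemma hs_lin i S a T T' : hs_form i (a *: T + T') S = a * hs_form i T S + hs_form i T' S.
Proof.
by rewrite /hs_form mulr_sumr -big_split; apply: eq_bigr => f _; rewrite /= dot_lin.
Qed.

Lemma hs_conj i T S : hs_form i S T = Num.conj (hs_form i T S).
Proof. by rewrite /hs_form rmorph_sum; apply: eq_bigr => f _; exact: dotC. Qed.

Lemma hs_ge0 i T : 0 <= Re (hs_form i T T).
Proof. by rewrite hs_formE hs_sq_ge0. Qed.

Lemma hs_directed (i j : {s : seq K | ons s}) : exists k, forall T, hs_dom T ->
  Re (hs_form i T T) <= Re (hs_form k T T) /\ Re (hs_form j T T) <= Re (hs_form k T T).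
Proof.
case: i j => [s os] [r or]; have [t ot tP] := gram_schmidt r os.
exists (exist _ (t ++ s) ot) => T [Tl _]; rewrite !hs_formE /=; split.
  by rewrite hs_sq_cat lerDr hs_sq_ge0.
exact: hs_sq_span.
Qed.

Lemma hs_unit (u : K) : nsq u = 1 -> ons [:: u].
Proof. by move=> u1; split. Qed.

Lemma hs_sep T : hs_dom T -> (forall i, Re (hs_form i T T) = 0) -> T = 0.
Proof.
move=> [Tl _] T0; apply/funext => x; apply: nsq_eq0.
apply/eqP; rewrite eq_le nsq_ge0 andbT -(mul0r (nsq x)).
apply: unit_bound_scale => // u u1.
by have := T0 (exist _ [:: u] (hs_unit u1)); rewrite hs_formE /hs_sq big_seq1 => ->.
Qed.

Lemma hs_complete (T : nat -> K -> K) : (forall n, hs_dom (T n)) ->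
  (forall e : R, 0 < e -> exists N, forall m n, (N <= m)%N -> (N <= n)%N ->
    forall i, Re (hs_form i (T m - T n) (T m - T n)) <= e) ->
  exists2 S, hs_dom S & forall i (e : R), 0 < e -> exists N, forall n, (N <= n)%N ->
    Re (hs_form i (T n - S) (T n - S)) <= e.
Proof.
move=> Td TC.
have TxC x (e : R) : 0 < e -> exists N, forall m n, (N <= m)%N -> (N <= n)%N ->
    nsq (T m x - T n x) <= e.
  move=> e0; have x1 : 0 < nsq x + 1 by rewrite ltr_wpDl ?nsq_ge0.
  have [N NP] := TC _ (divr_gt0 e0 x1); exists N => m n Nm Nn.
  apply: le_trans (_ : e / (nsq x + 1) * nsq x <= _).
    have [TTl _] : hs_dom (T m - T n) by rewrite addrC -scaleN1r; apply: hs_domP.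
    apply: (@unit_bound_scale (T m - T n) _ x TTl) => u u1.
     have := NP m n Nm Nn (exist _ [:: u] (hs_unit u1)).
    by rewrite hs_formE /hs_sq big_seq1.
  by rewrite mulrAC ler_pdivrMr// (ler_wpM2l (ltW e0))// lerDl.
have /(_ _)/cid-/all_sig[S SP] := fun x => nsq_cauchy_cvg (TxC x).
have small (x : K) : (forall e : R, 0 < e -> nsq x <= e) -> x = 0.
  move=> H; apply: nsq_eq0; apply/eqP; rewrite eq_le nsq_ge0 andbT.
  by apply/ler_addgt0Pl => e e0; rewrite addr0; exact: H.
have Sl : linear S.
  move=> a x y; apply/eqP; rewrite -subr_eq0; apply/eqP/small => e e0.
  (* Applying [nsqD_le] twice to three errors of size [p] gives [2 * (p + 2 * (normsq a * p + p))],
     which is [C * p]. *)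
  pose C := 6 + 4 * normsq a.
  have C0 : 0 < C by have := normsq_ge0 a; rewrite /C; lra.
  have eC := divr_gt0 e0 C0.
  have [N1 P1] := SP (a *: x + y) _ eC; have [N2 P2] := SP x _ eC; have [N3 P3] := SP y _ eC.
  pose n := maxn N1 (maxn N2 N3).
  have {}P1 := P1 n (leq_maxl _ _).
  have {}P2 := P2 n (leq_trans (leq_maxl _ _) (leq_maxr _ _)).
  have {}P3 := P3 n (leq_trans (leq_maxr _ _) (leq_maxr _ _)).
  have [Tl _] := Td n.
  have -> : S (a *: x + y) - (a *: S x + S y) =
      - (T n (a *: x + y) - S (a *: x + y)) + (a *: (T n x - S x) + (T n y - S y)).
    have -> : a *: (T n x - S x) + (T n y - S y) =
        T n (a *: x + y) - (a *: S x + S y).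
      by rewrite Tl scalerBr addrACA -opprD.
    by rewrite opprB addrA subrK.
  have := nsqD_le (- (T n (a *: x + y) - S (a *: x + y))) (a *: (T n x - S x) + (T n y - S y)).
  have := nsqD_le (a *: (T n x - S x)) (T n y - S y).
  rewrite nsqN nsqZ => le1 le2.
  have le3 := ler_wpM2l (normsq_ge0 a) P2.
  have -> : e = e / C * (6 + 4 * normsq a) by rewrite divfK// gt_eqF.
  by move: le1 le2 le3 P1 P3; set p := e / C; lra.
exists S.
  split=> // x Wx; apply: small => e e0; have [N NP] := SP x e e0.
  have := NP N (leqnn _); have [_ ->//] := Td N.
  by rewrite sub0r nsqN.
move=> [s os] e; elim: s {os}(os) e => [|f s IH] os e e0.
  by exists 0%N => n _; rewrite hs_formE /hs_sq big_nil ltW.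
have os' : ons s by case: os.
have e2 : 0 < e / 2 by rewrite divr_gt0.
have [N NP] := IH os' _ e2; have [M MP] := SP f _ e2.
exists (maxn N M) => n; rewrite geq_max => /andP[/NP + /MP].
rewrite !hs_formE /hs_sq big_cons /= => le1 le2.
by rewrite [e]splitr lerD.
Qed.

Definition hilbert_schmidt : directed_forms (K -> K) := 
  @DirectedForms R (K -> K) hs_dom {s : seq K | ons s} hs_form (exist _ [::] I)
    hs_dom0 hs_domP hs_lin hs_conj hs_ge0 hs_directed hs_sep hs_complete.

End HilbertSchmidt.

(** * The top eigenspace of T^* T for a Hilbert-Schmidt operator T *)

Section TopEigenspace.
Variables (R : realType) (K : hilbertType R) (T : K -> K) (M : R).
Hypothesis Tl : linear T.
Hypothesis T_hs : forall s, ons s -> hs_sq s T <= M.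
Variable x0 : K.
Hypothesis Tx0 : T x0 != 0.

Let E1 := [set nsq (T u) | u in [set u | nsq u = 1]].

Let x0_neq0 : x0 != 0.
Proof. by apply: contraNneq Tx0 => ->; rewrite (linear_map0 Tl). Qed.

Let has_supE1 : has_sup E1.
Proof.
split; first by have [u u1 _] := normalize x0_neq0; exists (nsq (T u)); exists u.
exists M => _ [u u1 <-]; have := T_hs (hs_unit u1).
by rewrite /hs_sq big_seq1.
Qed.

Definition op_sq : R := sup E1.
Local Notation lam := op_sq.

Lemma op_sq_ub x : nsq (T x) <= lam * nsq x.
Proof.
apply: (unit_bound_scale _ Tl) => u u1.
by apply: sup_upper_bound; [exact: has_supE1|exists u].
Qed.

Lemma op_sq_gt0 : 0 < lam.
Proof.
rewrite ltNge; apply/negP => l0; have := op_sq_ub x0.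
have := nsq_gt0 Tx0; have := nsq_gt0 x0_neq0; nra.
Qed.

(** The form of the operator [lam - T^* T], written without an adjoint. It is positive semidefinite,
    and its isotropic vectors are the top eigenvectors. *)
Definition defect x y : R[i] := lam%:C * dot x y - dot (T x) (T y).

Lemma defect_lin z a x y : defect (a *: x + y) z = a * defect x z + defect y z.
Proof. by rewrite /defect Tl !dot_lin; ring. Qed.

Lemma defectC x y : defect y x = Num.conj (defect x y).
Proof.
rewrite /defect rmorphB rmorphM /= -!dotC; congr (_ * _ - _).
by apply: complex_eqP; rewrite ?cRe_conj ?cIm_conj //= oppr0.
Qed.

Lemma defectxx x : Re (defect x x) = lam * nsq x - nsq (T x).
Proof. by rewrite /defect cReD cReN cReM /= mul0r subr0. Qed.

Lemma defect_ge0 x : 0 <= Re (defect x x).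
Proof. by rewrite defectxx subr_ge0 op_sq_ub. Qed.

Definition perp (s : seq K) (x : K) := forall f, f \in s -> dot x f = 0 :> R[i].

Definition coercive_on (s : seq K) :=
  exists2 c : R, 0 < c & forall x, perp s x -> c * nsq x <= Re (defect x x).

Lemma perp_closed s (z : nat -> K) v : (forall n, perp s (z n)) ->
  (forall e : R, 0 < e -> exists N, forall n, (N <= n)%N -> nsq (z n - v) <= e) ->
  perp s v.
Proof.
move=> zs zv f fs; apply: normsq_eq0; apply/eqP; rewrite eq_le normsq_ge0 andbT.
apply/ler_addgt0Pl => e e0; rewrite addr0.
have f1 : 0 < nsq f + 1 by rewrite ltr_wpDl ?nsq_ge0.
have [N NP] := zv _ (divr_gt0 e0 f1).
have -> : dot v f = dot (v - z N) f by rewrite dotBl zs// subr0.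
apply: le_trans (dot_cauchy_schwarz _ _) _; rewrite nsqBC.
apply: le_trans (_ : e / (nsq f + 1) * nsq f <= _).
  by rewrite ler_wpM2r ?nsq_ge0 ?NP.
by rewrite mulrAC ler_pdivrMr// (ler_wpM2l (ltW e0))// lerDl.
Qed.

(* Minimizing [defect] over [f + perp (f :: s)] gives a vector [w] that is
   [defect]-orthogonal to [perp (f :: s)]: either it is isotropic, or [defect] is
   coercive on [perp s], which is spanned by [w] and [perp (f :: s)]. *)
Lemma coercive_step f s : ons (f :: s) -> coercive_on (f :: s) ->
  (exists2 x, x != 0 & Re (defect x x) = 0) \/ coercive_on s.
Proof.
move=> /= [f1 fs _] [c c0 cP].
have [||||z zs zP] := @exists_minimizer _ _ defect defect_lin defectC defect_ge0
   lam c (perp (f :: s)) _ _ _ _ c0 cP f.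
- by move=> x; rewrite defectxx lerBlDr lerDl nsq_ge0.
- by move=> g _; rewrite dot0l.
- by move=> t u v us vs g gs; rewrite dot_lin us// vs// mulr0 addr0.
- exact: perp_closed.
pose w := f + z.
have wf : dot w f = 1 by rewrite dotDl dotxx f1 (zs f) ?mem_head ?addr0.
have ws g : g \in s -> dot w g = 0.
  by move=> gs; rewrite dotDl fs// (zs g) ?inE ?gs ?orbT ?addr0.
have w0 : w != 0.
  by apply: contra_eq_neq wf => ->; rewrite dot0l eq_sym oner_neq0.
have [dw|dw] := eqVneq (Re (defect w w)) 0; first by left; exists w.
right; pose d := Re (defect w w).
have d0 : 0 < d by rewrite lt_def dw defect_ge0.
have nw := nsq_gt0 w0.
(* For [x = t *: w + y], [nsq x] is at most [2 * (normsq t * nsq w + nsq y)]; the two entries of the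
   minimum match the two summands. *)
pose c' := Num.min (d / (2 * nsq w)) (c / 2).
have c'0 : 0 < c' by rewrite lt_min !divr_gt0// mulr_gt0.
exists c' => // x xs; pose t := dot x f; pose y := x - t *: w.
have yP : perp (f :: s) y.
  move=> g; rewrite inE => /predU1P[->|gs]; first by rewrite dotBl dotZl wf mulr1 subrr.
  by rewrite dotBl dotZl ws// mulr0 xs// subrr.
have xE : x = t *: w + y by rewrite addrC subrK.
have qx : Re (defect x x) = normsq t * d + Re (defect y y).
  rewrite [in LHS]xE (sq_formD defect_lin defectC) (sq_formZ defect_lin defectC).
  have -> : defect (t *: w) y = 0 by rewrite (formZl defect_lin) (zP y yP) mulr0.
  by rewrite /= mulr0 addr0.
have := nsqD_le (t *: w) y; rewrite -xE nsqZ qx => le1.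
have := cP y yP => le2.
have c1 : c' * (2 * nsq w) <= d.
  by rewrite -ler_pdivlMr ?mulr_gt0// ge_min lexx.
have c2 : 2 * c' <= c by rewrite mulrC -ler_pdivlMr// ge_min lexx orbT.
have := ler_wpM2l (normsq_ge0 t) c1; have := ler_wpM2r (nsq_ge0 y) c2.
have := ler_wpM2l (ltW c'0) le1; lra.
Qed.

(* Off a finite orthonormal list carrying most of the Hilbert-Schmidt norm of [T],
   [defect] is coercive; removing the list one vector at a time, it would end up
   coercive on the whole space, against the definition of [op_sq]. *)
Lemma top_eigenvector : exists2 x, x != 0 & Re (defect x x) = 0.
Proof.
have [[s os] cs] : exists s : {s : seq K | ons s}, coercive_on (sval s).
  pose S := [set hs_sq s T | s in [set s | ons s]].
  have hasS : has_sup S.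
    split; first by exists (hs_sq [::] T); exists [::].
    by exists M => _ [s os <-]; exact: T_hs.
  (* A list within [lam / 2] of the supremum leaves at most [lam / 2] for [nsq (T u)] at any further
     orthonormal vector [u], so [defect] is at least [lam / 2] there. *)
  have l2 : 0 < lam / 2 by rewrite divr_gt0 ?op_sq_gt0.
  have [_ [s os <-] sP] := sup_adherent l2 hasS.
  exists (exist _ s os) => /=; exists (lam / 2) => // x xs.
  rewrite defectxx.
  have [->|/normalize[u u1 xE]] := eqVneq x 0.
    by rewrite (linear_map0 Tl) !nsq0; lra.
  have [x00|xn0] := eqVneq (nsq x) 0.
    by rewrite (nsq_eq0 x00) (linear_map0 Tl) !nsq0; lra.
  have rt : (Num.sqrt (nsq x))%:C != 0 :> R[i].
    by apply/negP => /eqP[] /eqP; rewrite sqrtr_eq0 leNgt lt_def xn0 nsq_ge0.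
  have ou : ons (u :: s).
    split=> // f fs; have := xs f fs; rewrite xE dotZl => /eqP.
    by rewrite mulf_eq0 (negPf rt) => /eqP.
  have : hs_sq (u :: s) T <= sup S by apply: sup_upper_bound => //; exists (u :: s).
  rewrite /hs_sq big_cons -/(hs_sq s T) => le1.
  have uP : nsq (T u) <= lam / 2 by move: sP; lra.
  have -> : nsq (T x) = nsq x * nsq (T u).
    by rewrite [in LHS]xE (linear_mapZ Tl) nsqZ /normsq /= expr0n addr0 sqr_sqrtr ?nsq_ge0.
  by have := ler_wpM2l (nsq_ge0 x) uP; lra.
elim: s os cs => [|f s IH] /= os cs.
  case: cs => c c0 cP; exfalso.
  have : lam <= lam - c.
    apply: ge_sup; first by case: has_supE1.
    move=> _ [u u1 <-]; have := cP u; rewrite defectxx u1 => /(_ _).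
    by rewrite !mulr1 => H; have := H (fun f => ltac:(by [])); lra.
  lra.
have [//|] := coercive_step os cs; apply: IH.
by case: os.
Qed.

(** Each unit eigenvector contributes [lam] to a Hilbert-Schmidt sum bounded by [M], so orthonormal
    lists of eigenvectors have bounded length and a longest one spans the eigenspace. An isometry
    [U] commuting with [T] preserves [defect x x], hence the eigenspace. *)
Lemma top_eigenspace_ons : exists s, [/\ ons s, s <> [::],
  forall f, f \in s -> T f != 0 &
  forall U : K -> K, (forall x, nsq (U x) = nsq x) -> (forall x, T (U x) = U (T x)) ->
    forall f, f \in s -> proj s (U f) = U f].
Proof.
pose E x := Re (defect x x) = 0.
have EP t x y : E x -> E y -> E (t *: x + y).
  rewrite /E => Ex Ey.
  by rewrite (sq_formD defect_lin defectC) (sq_formZ defect_lin defectC) Ex Ey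
    (form_eq0 defect_lin defectC defect_ge0 _ Ey) mulr0 /= mulr0 !addr0.
have E0 : E 0 by rewrite /E (form0l defect_lin).
have ET x : E x -> nsq (T x) = lam * nsq x.
  by rewrite /E defectxx => /eqP; rewrite subr_eq0 => /eqP.
have EZ t x : E x -> E (t *: x) by move=> Ex; rewrite -[_ *: x]addr0; exact: EP.
pose Q n := `[<exists s, [/\ ons s, forall f, f \in s -> E f & size s = n]>].
have exQ : exists n, Q n by exists 0%N; apply/asboolP; exists [::].
have ubQ n : Q n -> (n <= (Num.truncn (M / lam)).+1)%N.
  move=> /asboolP[s [os sE <-]].
  have := T_hs os; rewrite /hs_sq big_seq.
  have -> : \sum_(f <- s | f \in s) nsq (T f) = lam * (size s)%:R.
    rewrite -big_seq -sum1_size natr_sum mulr_sumr big_seq [RHS]big_seq.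
    by apply: eq_bigr => f fs; rewrite (ET _ (sE f fs)) (ons_nsq os fs).
  rewrite mulrC -ler_pdivlMr ?op_sq_gt0// => le1.
  by rewrite -(ler_nat R); apply: le_trans le1 (ltW (truncnS_gt _)).
case: (ex_maxnP exQ ubQ) => n /asboolP[s [os sE sn]] nmax.
have sP x : E x -> proj s x = x.
  move=> Ex; apply/eqP/negPn/negP => px.
  have Ep : E (proj s x).
    rewrite /proj big_seq; apply: (big_ind E) => //.
      by move=> u v Eu Ev; rewrite -[u]scale1r; exact: EP.
    by move=> f fs; apply: EZ; exact: sE.
  have y0 : x - proj s x != 0 by rewrite subr_eq0 eq_sym.
  have Ey : E (x - proj s x) by rewrite addrC -scaleN1r; exact: EP.
  pose a := (Num.sqrt (nsq (x - proj s x)))^-1; pose u := a%:C *: (x - proj s x).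
  have u1 : nsq u = 1.
    rewrite nsqZ /normsq /= expr0n addr0 /a exprVn sqr_sqrtr ?nsq_ge0//.
    by rewrite mulVf// gt_eqF// nsq_gt0.
  have : (n.+1 <= n)%N; last by rewrite ltnn.
  apply: nmax; apply/asboolP; exists (u :: s); split; last by rewrite /= sn.
    by split=> // f fs; rewrite dotZl dot_sub_proj// mulr0.
  by move=> f; rewrite inE => /predU1P[->|/sE//]; exact: EZ.
exists s; split=> //.
- move=> s0; have [x xn Ex] := top_eigenvector.
  by have := sP x Ex; rewrite s0 /proj big_nil => x00; rewrite -x00 eqxx in xn.
- move=> f fs; apply: contraTneq op_sq_gt0 => Tf.
  by have := ET f (sE f fs); rewrite Tf nsq0 (ons_nsq os fs) mulr1 => <-; rewrite ltxx.
- move=> U Un UT f fs; apply: sP; rewrite /E defectxx UT !Un.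
  by rewrite -defectxx; exact: sE.
Qed.

End TopEigenspace.

(** * Malcev's theorem *)

Section FiniteQuotientsOfRings.
Variable L : numFieldType.
Implicit Types (S : L -> Prop) (p q r u : {poly L}).

Definition is_subring S :=
  [/\ S 1, forall x y, S x -> S y -> S (x - y) & forall x y, S x -> S y -> S (x * y)].

(** Homomorphisms are total functions constrained on [S] alone, so that subrings can stay predicates
    on [L] while generators are adjoined one by one. *)
Definition ring_hom_on S (F : nzRingType) (f : L -> F) :=
  [/\ f 1 = 1, forall x y, S x -> S y -> f (x - y) = f x - f y &
      forall x y, S x -> S y -> f (x * y) = f x * f y].

Definition finitely_separated S := forall s, S s -> s != 0 ->
  exists (F : finFieldType) (f : L -> F), ring_hom_on S f /\ f s != 0.

Definition int_ring (x : L) := exists z : int, x = z%:~R.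

Lemma int_ring_subring : is_subring int_ring.
Proof.
split; first by exists 1.
  by move=> _ _ [z ->] [w ->]; exists (z - w); rewrite rmorphB.
by move=> _ _ [z ->] [w ->]; exists (z * w); rewrite rmorphM.
Qed.

(** A nonzero integer survives modulo any prime larger than its absolute value. Outside the integers
    the map takes the default value 0. *)
Lemma int_ring_separated : finitely_separated int_ring.
Proof.
move=> _ [z ->] z0; have {}z0 : z != 0 by apply: contraNneq z0 => ->.
have [p zp pp] := prime_above `|z|%N.
pose f (x : L) : 'F_p :=
  if pselect (int_ring x) is left e then (projT1 (cid e))%:~R else 0.
have fE w : f w%:~R = w%:~R.
  rewrite /f; case: pselect => [e|[]]; last by exists w.
  by case: cid => v /= /intr_inj ->.
exists 'F_p, f; split; first split.
- by rewrite -[1 in LHS]/(1%:~R) fE.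
- by move=> _ _ [v ->] [w ->]; rewrite -rmorphB !fE rmorphB.
- by move=> _ _ [v ->] [w ->]; rewrite -rmorphM !fE rmorphM.
rewrite fE; apply/negP => /eqP zF.
have : (`|z|%N)%:R == 0 :> 'F_p.
  by case: z zF {zp z0 fE} => n /=; rewrite ?NegzE ?rmorphN => /eqP; rewrite ?oppr_eq0.
rewrite -(dvdn_pcharf (pchar_Fp pp)) => /dvdn_leq; rewrite absz_gt0 z0 => /(_ isT).
by rewrite leqNgt zp.
Qed.

Lemma finField_root (F : finFieldType) (p : {poly F}) : (1 < size p)%N ->
  exists (F' : finFieldType) (i : {rmorphism F -> F'}) (a : F'), root (map_poly i p) a.
Proof.
move=> p1; have p0 : p != 0 by apply: contraTneq p1 => ->; rewrite size_poly0.
have [E [rs prs _]] := FinSplittingFieldFor p0.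
have sz : size (map_poly (in_alg E) p) = size p by rewrite size_map_poly.
exists (finvect_type E), (in_alg E).
have := eqp_size prs; rewrite sz size_prod_XsubC.
case: rs prs => [|a rs] prs; first by move=> sp; rewrite sp in p1.
move=> _; exists a; change (root (map_poly (in_alg E) p) a).
by rewrite (eqp_root prs) root_prod_XsubC mem_head.
Qed.

Section Adjoin.
Variables (S : L -> Prop) (a : L).
Hypothesis S_ring : is_subring S.

Let S1 : S 1. Proof. by case: S_ring. Qed.
Let SB x y : S x -> S y -> S (x - y). Proof. by case: S_ring => _ + _; apply. Qed.
Let SM x y : S x -> S y -> S (x * y). Proof. by case: S_ring => _ _; apply. Qed.
Let S0 : S 0. Proof. by rewrite -(subrr 1); apply: SB. Qed.
Let SN x : S x -> S (- x). Proof. by rewrite -sub0r; apply: SB. Qed.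
Let SD x y : S x -> S y -> S (x + y).
Proof. by move=> Sx Sy; rewrite -[y]opprK; apply: SB => //; exact: SN. Qed.
Let SX x n : S x -> S (x ^+ n).
Proof. by move=> Sx; elim: n => [|n IH]; rewrite ?expr0// exprS; exact: SM. Qed.

Definition poly_in p := forall i, S p`_i.

Lemma poly_in0 : poly_in 0. Proof. by move=> i; rewrite coef0. Qed.
Lemma poly_inC c : S c -> poly_in c%:P.
Proof. by move=> Sc i; rewrite coefC; case: ifP. Qed.
Lemma poly_inX : poly_in 'X. Proof. by move=> i; rewrite coefX; case: eqP. Qed.
Lemma poly_inB p q : poly_in p -> poly_in q -> poly_in (p - q).
Proof. by move=> Sp Sq i; rewrite coefB; exact: SB. Qed.
Lemma poly_inD p q : poly_in p -> poly_in q -> poly_in (p + q).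
Proof. by move=> Sp Sq i; rewrite coefD; exact: SD. Qed.
Lemma poly_inM p q : poly_in p -> poly_in q -> poly_in (p * q).
Proof.
by move=> Sp Sq i; rewrite coefM; apply: (big_ind S) => // j _; exact: SM.
Qed.
Lemma poly_inZ c p : S c -> poly_in p -> poly_in (c *: p).
Proof. by move=> Sc Sp i; rewrite coefZ; exact: SM. Qed.
Lemma poly_inXn n : poly_in 'X^n.
Proof. by move=> i; rewrite coefXn; case: eqP. Qed.

Definition adjoin (x : L) := exists2 p, poly_in p & x = p.[a].

Lemma adjoin_subring : is_subring adjoin.
Proof.
split; first by exists 1%:P; [exact: poly_inC|rewrite hornerC].
  by move=> _ _ [p Sp ->] [q Sq ->]; exists (p - q); [exact: poly_inB|rewrite !hornerE].
by move=> _ _ [p Sp ->] [q Sq ->]; exists (p * q); [exact: poly_inM|rewrite !hornerE].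
Qed.

Lemma adjoin_sub x : S x -> adjoin x.
Proof. by move=> Sx; exists x%:P; [exact: poly_inC|rewrite hornerC]. Qed.

Lemma adjoin_gen : adjoin a.
Proof. by exists 'X; [exact: poly_inX|rewrite hornerX]. Qed.

(** Scaling by powers of the leading coefficient, instead of inverting it, keeps quotient and
    remainder over [S]. *)
Lemma pseudo_division p q : poly_in p -> poly_in q -> q != 0 ->
  exists k u r, [/\ poly_in u, poly_in r, lead_coef q ^+ k *: p = u * q + r &
                    (size r < size q)%N].
Proof.
move=> Sp Sq q0; have [n] := ubnP (size p); elim: n p Sp => // n IH p Sp pn.
have [pq|qp] := ltnP (size p) (size q).
  exists 0%N, 0, p; rewrite expr0 scale1r mul0r add0r.
  by split=> //; exact: poly_in0.
set c := lead_coef q; set d := lead_coef p; pose m : {poly L} := 'X^(size p - size q).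
have Sc : S c by exact: Sq.
have Sd : S d by exact: Sp.
have Sm : poly_in m by exact: poly_inXn.
have p0 : p != 0.
  by rewrite -size_poly_gt0; apply: leq_trans qp; rewrite size_poly_gt0.
pose p' := c *: p - d *: m * q.
have Sp' : poly_in p' by apply: poly_inB; [exact: poly_inZ|apply: poly_inM => //; exact: poly_inZ].
have p'p : (size p' < size p)%N.
  have sp : (0 < size p)%N by rewrite size_poly_gt0.
  have sq : (0 < size q)%N by rewrite size_poly_gt0.
  rewrite -(prednK sp) ltnS; apply/leq_sizeP => j jp.
  rewrite /p' coefB coefZ -scalerAl coefZ coefXnM ltnNge.
  have -> /= : (size p - size q <= j)%N.
    by apply: leq_trans jp; rewrite -subn1 leq_sub2l.
  move: jp; rewrite leq_eqVlt => /predU1P[<-|].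
    have -> : ((size p).-1 - (size p - size q) = (size q).-1)%N by lia.
    by rewrite -/(lead_coef p) -/(lead_coef q) mulrC subrr.
  rewrite prednK// => pj; rewrite !nth_default ?mulr0 ?subrr//.
  by apply: leq_trans (leq_sub2r _ pj); rewrite subKn.
have [k [u [r [Su Sr E rq]]]] := IH p' Sp' (leq_trans p'p pn).
exists k.+1, (u + c ^+ k *: (d *: m)), r; split=> //.
  by apply: poly_inD => //; apply: poly_inZ; [exact: SX|exact: poly_inZ].
rewrite exprSr -scalerA mulrDl addrAC -E /p' scalerBr.
by rewrite -!scalerAl subrK.
Qed.

Section Hom.
Variables (F : fieldType) (f : L -> F).
Hypothesis f_hom : ring_hom_on S f.

Lemma hom_onB x y : S x -> S y -> f (x - y) = f x - f y.
Proof. by case: f_hom => _ + _; apply. Qed.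

Lemma hom_onM x y : S x -> S y -> f (x * y) = f x * f y.
Proof. by case: f_hom => _ _; apply. Qed.

Lemma hom_on1 : f 1 = 1. Proof. by case: f_hom. Qed.

Lemma hom_on0 : f 0 = 0.
Proof. by rewrite -(subrr (1 : L)) hom_onB// subrr. Qed.

Lemma hom_onD x y : S x -> S y -> f (x + y) = f x + f y.
Proof.
move=> Sx Sy; rewrite -[y in LHS]opprK hom_onB//; last exact: SN.
by rewrite -[- y]sub0r hom_onB// hom_on0 sub0r opprK.
Qed.

Lemma hom_on_sum n (G : 'I_n -> L) : (forall i, S (G i)) ->
  f (\sum_i G i) = \sum_i f (G i).
Proof.
move=> SG.
have [] : S (\sum_i G i) /\ f (\sum_i G i) = \sum_i f (G i); last by [].
apply: (big_ind2 (fun x y => S x /\ f x = y)); first by split=> //; exact: hom_on0.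
  by move=> x _ y _ [Sx <-] [Sy <-]; rewrite hom_onD//; split=> //; exact: SD.
by move=> i _; split.
Qed.

Lemma map_poly_onB p q : poly_in p -> poly_in q ->
  map_poly f (p - q) = map_poly f p - map_poly f q.
Proof.
move=> Sp Sq; apply/polyP => i.
by rewrite coefB !coef_map_id0 ?hom_on0// coefB hom_onB.
Qed.

Lemma map_poly_onM p q : poly_in p -> poly_in q ->
  map_poly f (p * q) = map_poly f p * map_poly f q.
Proof.
move=> Sp Sq; apply/polyP => i.
rewrite coefM coef_map_id0 ?hom_on0// coefM hom_on_sum; last by move=> j; exact: SM.
by apply: eq_bigr => j _; rewrite !coef_map_id0 ?hom_on0// hom_onM.
Qed.

Lemma map_poly_onC c : map_poly f c%:P = (f c)%:P.
Proof.
apply/polyP => i; rewrite coef_map_id0 ?hom_on0// !coefC.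
by case: ifP => // _; exact: hom_on0.
Qed.

Lemma map_poly_onZ c p : S c -> poly_in p -> map_poly f (c *: p) = f c *: map_poly f p.
Proof.
by move=> Sc Sp; rewrite -!mul_polyC map_poly_onM ?map_poly_onC//; exact: poly_inC.
Qed.

(** The hypothesis says that [al] satisfies the image of every relation of [a] over [S]; this makes
    the value independent of the polynomial representing an element. *)
Lemma adjoin_hom (al : F) :
  (forall p, poly_in p -> p.[a] = 0 -> (map_poly f p).[al] = 0) ->
  exists2 g : L -> F, ring_hom_on adjoin g &
    forall p, poly_in p -> g p.[a] = (map_poly f p).[al].
Proof.
move=> al0.
pose g (x : L) : F := if pselect (adjoin x) is left e then
  (map_poly f (projT1 (cid2 e))).[al] else 0.
have gE p : poly_in p -> g p.[a] = (map_poly f p).[al].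
  move=> Sp; rewrite /g; case: pselect => [e|[]]; last by exists p.
  case: cid2 => q /= Sq pq; apply/eqP; rewrite -subr_eq0 -hornerN -hornerD.
  rewrite -map_poly_onB//; apply/eqP/al0; first exact: poly_inB.
  by rewrite !hornerE pq subrr.
exists g => //; split.
- rewrite -[1 in LHS](hornerC 1 a) gE; last exact: poly_inC.
  by rewrite map_poly_onC hornerC hom_on1.
- move=> _ _ [p Sp ->] [q Sq ->]; rewrite -hornerN -hornerD !gE//; last exact: poly_inB.
  by rewrite map_poly_onB// !hornerE.
- move=> _ _ [p Sp ->] [q Sq ->]; rewrite -hornerM !gE//; last exact: poly_inM.
  by rewrite map_poly_onM// !hornerE.
Qed.

End Hom.

Lemma hom_on_comp (F F' : fieldType) (f : L -> F) (i : {rmorphism F -> F'}) :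
  ring_hom_on S f -> ring_hom_on S (i \o f).
Proof.
move=> [f1 fB fM]; split=> /=; first by rewrite f1 rmorph1.
  by move=> x y Sx Sy; rewrite fB// rmorphB.
by move=> x y Sx Sy; rewrite fM// rmorphM.
Qed.

Lemma map_poly_on_comp (F F' : fieldType) (f : L -> F) (i : {rmorphism F -> F'}) p :
  ring_hom_on S f -> map_poly (i \o f) p = map_poly i (map_poly f p).
Proof.
move=> fh; have f0 := hom_on0 fh.
by apply/polyP => j; rewrite coef_map !coef_map_id0//= f0 rmorph0.
Qed.

(** Provides a nonzero multiple of [r.[a]] in [S], which the separation of [S] can keep alive.
    Pseudo-dividing [q] by [r] makes [- r'.[a]] a multiple of [r.[a]] with a smaller [r']. It is
    nonzero: otherwise minimality of [q] forces [r' = 0], then [u.[a] = 0] with [u] shorter than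
    [q], so [u = 0]. *)
Lemma algebraic_bezout q : poly_in q -> q != 0 -> q.[a] = 0 ->
  (forall p, poly_in p -> p.[a] = 0 -> (size p < size q)%N -> p = 0) ->
  forall r, poly_in r -> r.[a] != 0 -> (size r < size q)%N ->
  exists u e, [/\ poly_in u, S e, e != 0 & u.[a] * r.[a] = e].
Proof.
move=> Sq q0 qa qmin r; have [n] := ubnP (size r); elim: n r => // n IH r rn Sr ra rq.
have r0 : r != 0 by apply: contraNneq ra => ->; rewrite horner0.
have [/size1_polyC rC|r1] := leqP (size r) 1.
  exists 1%:P, r`_0; rewrite {3}rC !hornerC mul1r; split=> //; first exact: poly_inC.
  by apply: contraNneq ra => rr; rewrite rC rr hornerC.
have [k [u [r' [Su Sr' E r'r]]]] := pseudo_division Sq Sr r0.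
have Ea : u.[a] * r.[a] + r'.[a] = 0.
  by rewrite -hornerM -hornerD -E hornerZ qa mulr0.
have r'a : r'.[a] != 0.
  apply/negP => /eqP r'a; move: Ea; rewrite r'a addr0 => /eqP.
  rewrite mulf_eq0 (negPf ra) orbF => /eqP ua.
  have r'0 := qmin _ Sr' r'a (ltn_trans r'r rq).
  have szq : size (u * r) = size q.
    by rewrite -[u * r]addr0 -r'0 -E size_scale// expf_neq0// lead_coef_eq0.
  have u0 : u != 0.
    by apply: contraNneq q0 => u0; rewrite -size_poly_eq0 -szq u0 mul0r size_poly0.
  have : u = 0; last by move=> /eqP; rewrite (negPf u0).
  apply: qmin => //; rewrite -szq size_mul//.
  by move: r1; case: (size r) => [|[|m]]// _; rewrite !addnS /= ltnS leq_addr.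
have [v [e [Sv Se e0 ve]]] := IH r' (leq_trans r'r rn) Sr' r'a (ltn_trans r'r rq).
exists (- v * u), e; split=> //.
  by apply: poly_inM => //; rewrite -sub0r; apply: poly_inB => //; exact: poly_in0.
rewrite hornerM hornerN -mulrA -ve mulNr -mulrN; congr (_ * _).
by apply/eqP; rewrite eq_sym -subr_eq0 opprK addrC Ea.
Qed.

(* If [a] is algebraic with minimal relation [q], a hom that keeps [lead_coef q]
   and a nonzero multiple [e] of [s] in [S] nonzero extends by sending [a] to a
   root of the image of [q].  If [a] is transcendental and [s = sg.[a]], send [a]
   to a root [al] of [sg * 'X - 1], so that the image of [s] is invertible. *)
Lemma adjoin_separated : finitely_separated S -> finitely_separated adjoin.
Proof.
move=> Ssep _ [sg Ssg ->] sa0.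
pose Q n := `[<exists q, [/\ poly_in q, q != 0, q.[a] = 0 & size q = n]>].
have [exQ|nQ] := pselect (exists n, Q n); last first.
  have trans p : poly_in p -> p.[a] = 0 -> p = 0.
    move=> Sp pa; apply/eqP/negPn/negP => p0; apply: nQ.
    by exists (size p); apply/asboolP; exists p.
  have sg0 : sg != 0 by apply: contraNneq sa0 => ->; rewrite horner0.
  have [|F [f [fh ft]]] := Ssep (lead_coef sg) (Ssg _); first by rewrite lead_coef_eq0.
  have sz : size (map_poly f sg) = size sg by apply: size_map_poly_id0.
  have h1 : (1 < size (map_poly f sg * 'X - 1%:P)%R)%N.
    have fsg0 : map_poly f sg != 0 by rewrite -size_poly_gt0 sz size_poly_gt0.
    rewrite size_polyDl ?size_mulX//; first by rewrite sz ltnS size_poly_gt0.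
    by rewrite size_polyN size_poly1 ltnS sz size_poly_gt0.
  have [F' [i [al ral]]] := finField_root h1.
  have gh := hom_on_comp i fh.
  have [|g gring gE] := adjoin_hom gh (al := al).
    by move=> p Sp /(trans p Sp) ->; rewrite map_poly0 horner0.
  exists F', g; split=> //; rewrite gE// map_poly_on_comp//.
  apply: contraTneq ral => z; rewrite rootE rmorphB rmorphM /= map_polyX map_polyC /=.
  by rewrite !hornerE z mul0r rmorph1 sub0r oppr_eq0 oner_neq0.
case: (ex_minnP exQ) => n /asboolP[q [Sq q0 qa qn]] nmin.
have qmin p : poly_in p -> p.[a] = 0 -> (size p < size q)%N -> p = 0.
  move=> Sp pa pq; apply/eqP/negPn/negP => p0.
  have := nmin (size p); rewrite leqNgt -qn pq => H.
  by have : false by apply: H; apply/asboolP; exists p.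
have cS : S (lead_coef q) by exact: Sq.
have c0 : lead_coef q != 0 by rewrite lead_coef_eq0.
have [k [u [r [Su Sr E rq]]]] := pseudo_division Ssg Sq q0.
have ra : r.[a] = lead_coef q ^+ k * sg.[a].
  by rewrite -hornerZ E hornerD hornerM qa mulr0 add0r.
have ra0 : r.[a] != 0 by rewrite ra mulf_neq0// expf_neq0.
have [v [e [Sv Se e0 ve]]] := algebraic_bezout Sq q0 qa qmin Sr ra0 rq.
have [|F [f [fh ft]]] := Ssep (lead_coef q * e) (SM cS Se); first by rewrite mulf_neq0.
rewrite (hom_onM fh)// mulf_eq0 negb_or in ft; have /andP[fc fe] := ft.
have q1 : (1 < size q)%N.
  rewrite ltnNge; apply/negP => /size1_polyC qC.
  by move: qa q0; rewrite qC hornerC => ->; rewrite eqxx.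
have sz : size (map_poly f q) = size q by apply: size_map_poly_id0.
have [|F' [i [al ral]]] := @finField_root F (map_poly f q); first by rewrite sz.
have gh := hom_on_comp i fh.
have qal : (map_poly (i \o f) q).[al] = 0 by rewrite map_poly_on_comp//; exact/eqP.
have [|g gring gE] := adjoin_hom gh (al := al).
  (* A relation [p] of [a] is a multiple of [q] up to a power of [lead_coef q], whose image is
     nonzero; so [al] satisfies the image of [p] as well. *)
  move=> p Sp pa; have [k' [u' [r' [Su' Sr' E' r'q]]]] := pseudo_division Sp Sq q0.
  have r'0 : r' = 0.
    by apply: qmin => //; move/(congr1 (horner^~ a)): E'; rewrite /= !hornerE pa qa !mulr0 add0r.
  move/(congr1 (fun p => (map_poly (i \o f) p).[al])): E'.
  rewrite r'0 addr0 /= (map_poly_onM gh)// (map_poly_onZ gh)//; last exact: SX.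
  rewrite !hornerE qal mulr0 => /eqP; rewrite mulf_eq0 => /orP[|/eqP//].
  rewrite /= fmorph_eq0.
  have -> : f (lead_coef q ^+ k') = f (lead_coef q) ^+ k'.
    elim: k' => [|k' IH]; first by rewrite !expr0 (hom_on1 fh).
    by rewrite !exprS (hom_onM fh) ?IH//; exact: SX.
  by rewrite expf_eq0 (negPf fc) andbF.
exists F', g; split=> //.
have ge : g e = i (f e).
  by have := gE e%:P (poly_inC Se); rewrite hornerC (map_poly_onC gh) hornerC.
have : g e != 0 by rewrite ge fmorph_eq0.
apply: contraNneq => gs; rewrite -ve ra.
have [_ _ gM] := gring.
have Av : adjoin v.[a] by exists v.
have Asg : adjoin sg.[a] by exists sg.
have Ac : adjoin (lead_coef q ^+ k) by apply: adjoin_sub; exact: SX.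
have Acsg : adjoin (lead_coef q ^+ k * sg.[a]) by rewrite -ra; exists r.
by rewrite gM// gM// gs !mulr0.
Qed.

End Adjoin.
End FiniteQuotientsOfRings.

(** * Finitely generated linear groups *)

Section Malcev.

(** Generation as an induction principle on words in [s] without inverses, so that [malcev] needs
    the matrix entries of the listed generators and never inverts a matrix. *)
Definition monoid_generated (G : groupType) (s : seq G) := forall P : G -> Prop,
  P 1%g -> (forall x y, x \in s -> P y -> P (x * y)%g) -> forall g, P g.

Lemma subring_of_seq (L : numFieldType) (l : seq L) : exists S : L -> Prop,
  [/\ is_subring S, finitely_separated S & forall x, x \in l -> S x].
Proof.
elim: l => [|x l [S [Sr Ss Sl]]].
  by exists (@int_ring L); split=> //; [exact: int_ring_subring|exact: int_ring_separated].
exists (adjoin S x); split.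
- exact: adjoin_subring.
- exact: adjoin_separated.
- by move=> y; rewrite inE => /predU1P[->|/Sl]; [exact: adjoin_gen|exact: adjoin_sub].
Qed.

(** All entries lie in the ring generated by the entries of the generators. A homomorphism from this
    ring to a finite field that keeps a nonzero entry of [M g - 1] alive, applied entrywise, maps
    [G] to a finite general linear group. *)
Lemma malcev (L : numFieldType) (G : groupType) (s : seq G) (d : nat)
    (M : G -> 'M[L]_d) (g : G) : monoid_generated s -> M 1%g = 1%:M ->
  (forall x y, M (x * y)%g = M x *m M y) -> M g != 1%:M ->
  exists (K : finGroupType) (f : {multiplicative G -> K}), f g != 1%g.
Proof.
case: d M => [|d] M gen M1 MM Mg1.
  by move: Mg1; rewrite [M g]flatmx0 [1%:M]flatmx0 eqxx.
have [S [Sr Ss Sl]] := subring_of_seq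
  (flatten [seq [seq M x ij.1 ij.2 | ij : 'I_d.+1 * 'I_d.+1] | x <- s]).
have SM x i j : S (M x i j).
  move: i j; elim/gen: x => [|x y xs IH] i j.
    have S0 : S 0 by rewrite -(subrr 1); case: Sr => S1 SB _; exact: SB.
    by rewrite M1 mxE; case: eqP => _ //; case: Sr.
  have Sx k l : S (M x k l).
    by apply/Sl/flattenP; exists [seq M x ij.1 ij.2 | ij : 'I_d.+1 * 'I_d.+1];
       [exact: map_f|apply/mapP; exists (k, l); rewrite ?mem_enum].
  rewrite MM mxE; apply: (big_ind S).
  - by rewrite -(subrr 1); case: Sr => S1 SB _; exact: SB.
  - case: Sr => S1 SB _ u v Su Sv; rewrite -[v]opprK; apply: (SB) => //.
    by rewrite -sub0r; apply: (SB) => //; rewrite -(subrr 1); exact: SB.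
  - by move=> k _; case: Sr => _ _; apply.
have [i [j ij]] : exists i j, M g i j <> (1%:M : 'M[L]_d.+1) i j.
  apply: contrapT => nij; move/eqP: Mg1; apply; apply/matrixP => i j.
  by apply: contrapT => ij; apply: nij; exists i, j.
pose t := M g i j - (1%:M : 'M[L]_d.+1) i j.
have St : S t by case: (Sr) => _ SB _; rewrite /t -M1; exact: SB.
have t0 : t != 0 by rewrite subr_eq0; exact/eqP.
have [F [f [fh ft]]] := Ss t St t0.
pose N x := map_mx f (M x).
have f0 : f 0 = 0 by exact: (hom_on0 Sr fh).
have N1 : N 1%g = 1%:M.
  by apply/matrixP => k l; rewrite !mxE M1 mxE; case: eqP; rewrite ?(hom_on1 fh) ?f0.
have NM x y : N (x * y)%g = N x *m N y.
  apply/matrixP => k l; rewrite !mxE MM mxE (hom_on_sum Sr fh); last first.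
    by move=> m; case: (Sr) => _ _; apply.
  by apply: eq_bigr => m _; rewrite !mxE (hom_onM fh).
have Nunit x : N x \is a GRing.unit.
  have : N x *m N x^-1%g = 1%:M by rewrite -NM mulgV.
  by move=> /mulmx1_unit[].
pose phi x : {'GL_d.+1[F]} := FinRing.unit 'M[F]_d.+1 (Nunit x).
have phiM : {morph phi : x y / (x * y)%g}.
  by move=> x y; apply: val_inj; rewrite /= NM.
pose Phi : {multiplicative G -> {'GL_d.+1[F]}} :=
  HB.pack phi (isMultiplicative.Build G {'GL_d.+1[F]} phi phiM).
exists {'GL_d.+1[F]}, Phi; apply/negP => /eqP /(congr1 val) /= phig.
have {}phig : N g = N 1%g by rewrite N1; exact: phig.
move/matrixP: phig => /(_ i j); rewrite !mxE => Nij.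
move: ft; rewrite /t (hom_onB fh)//; last by rewrite -M1.
by rewrite Nij M1 subrr eqxx.
Qed.

End Malcev.

(** * Square-summable functions and finite generation *)

Section ScalarCompleteness.
Variable R : realType.

Lemma normsqN (z : R[i]) : normsq (- z) = normsq z.
Proof. by rewrite /normsq cReN cImN !sqrrN. Qed.

Lemma real_cauchy_cvg (x : nat -> R) :
  (forall e : R, 0 < e -> exists N, forall m n, (N <= m)%N -> (N <= n)%N ->
    `|x m - x n| <= e) ->
  exists v, forall e : R, 0 < e -> exists N, forall n, (N <= n)%N -> `|x n - v| <= e.
Proof.
move=> xC; have : cvg (x @ \oo).
  apply: cauchy_cvg; apply/cauchy_ballP => e e0.
  have [N NP] := xC (e / 2) (divr_gt0 e0 (ltr0Sn _ _)).
  exists ([set z | exists2 m, (N <= m)%N & z = x m],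
          [set z | exists2 m, (N <= m)%N & z = x m]) => /=.
    by split; exists N => // m /= Nm; exists m.
  move=> [y z] /= [[m Nm ->] [n Nn ->]]; rewrite -ball_normE /=.
  by apply: le_lt_trans (NP m n Nm Nn) _; lra.
move=> /cvg_ex[v xv]; exists v => e e0.
have /cvgrPdist_lt/(_ _ e0)[N _ NP] := xv.
by exists N => n Nn; have := NP n Nn; rewrite /= distrC => /ltW.
Qed.

Lemma complex_cauchy_cvg (x : nat -> R[i]) :
  (forall e : R, 0 < e -> exists N, forall m n, (N <= m)%N -> (N <= n)%N ->
    normsq (x m - x n) <= e) ->
  exists v, forall e : R, 0 < e -> exists N, forall n, (N <= n)%N -> normsq (x n - v) <= e.
Proof.
move=> xC.
have sq_le (a e : R) : 0 < e -> a ^+ 2 <= e ^+ 2 -> `|a| <= e.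
  by move=> e0 ae; rewrite -(ger0_norm (ltW e0)) -ler_sqr ?nnegrE// !real_normK ?num_real.
have [|a aP] := @real_cauchy_cvg (fun n => Re (x n)).
  move=> e e0; have [N NP] := xC _ (exprn_gt0 2 e0); exists N => m n Nm Nn.
  apply: sq_le => //; apply: le_trans (NP m n Nm Nn).
  by rewrite /normsq cReD cReN lerDl sqr_ge0.
have [|b bP] := @real_cauchy_cvg (fun n => Im (x n)).
  move=> e e0; have [N NP] := xC _ (exprn_gt0 2 e0); exists N => m n Nm Nn.
  apply: sq_le => //; apply: le_trans (NP m n Nm Nn).
  by rewrite /normsq cImD cImN lerDr sqr_ge0.
exists (a +i* b) => e e0.
have se : 0 < Num.sqrt (e / 2) by rewrite sqrtr_gt0 divr_gt0.
have [N NP] := aP _ se; have [M MP] := bP _ se.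
exists (maxn N M) => n; rewrite geq_max => /andP[/NP + /MP].
have sq_le' (c : R) : `|c| <= Num.sqrt (e / 2) -> c ^+ 2 <= e / 2.
  have e2 : 0 <= e / 2 by rewrite divr_ge0// ltW.
  move=> ce; rewrite -[leRHS]sqr_sqrtr//.
  by rewrite -real_normK ?num_real// ler_sqr ?nnegrE ?sqrtr_ge0.
move=> /sq_le' le1 /sq_le' le2.
by rewrite /normsq cReD cReN cImD cImN /=; lra.
Qed.

End ScalarCompleteness.

Section SquareSummable.
Variables (R : realType) (Y : choiceType) (X : Y -> Prop).
Implicit Types (v w : Y -> R[i]) (s r : seq Y).

Lemma ler_sum_uniq_sub s r (f : Y -> R) : uniq s -> uniq r -> {subset s <= r} ->
  (forall y, 0 <= f y) -> \sum_(y <- s) f y <= \sum_(y <- r) f y.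
Proof.
move=> us ur sr f0; rewrite [leRHS](bigID (mem s)) /= -[X in _ <= X + _]big_filter.
have /(perm_big _) -> : perm_eq [seq y <- r | y \in s] s.
  apply: uniq_perm => //; first exact: filter_uniq.
  by move=> y; rewrite mem_filter; case ys: (y \in s) => //=; exact: sr.
by rewrite lerDl sumr_ge0.
Qed.

(** The support condition lets a coset space be a predicate on [set G] instead of a type of its
    own. *)
Definition ell2_dom v : Prop := forall y, ~ X y -> v y = 0.

Definition ell2_form (i : {s : seq Y | uniq s}) v w : R[i] :=
  \sum_(y <- sval i) v y * Num.conj (w y).

Lemma ell2_formE i v : Re (ell2_form i v v) = \sum_(y <- sval i) normsq (v y).
Proof. by rewrite /ell2_form cRe_sum; apply: eq_bigr => y _; rewrite mul_conj_normsq. Qed.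

Lemma ell2_domP (a : R[i]) v w : ell2_dom v -> ell2_dom w -> ell2_dom (a *: v + w).
Proof.
move=> dv dw y Xy; change (a *: v y + w y = 0).
by rewrite dv// dw// scaler0 addr0.
Qed.

Lemma ell2_lin i w a u v : ell2_form i (a *: u + v) w = a * ell2_form i u w + ell2_form i v w.
Proof.
rewrite /ell2_form mulr_sumr -big_split; apply: eq_bigr => y _ /=.
change ((a * u y + v y) * Num.conj (w y) =
  a * (u y * Num.conj (w y)) + v y * Num.conj (w y)).
by ring.
Qed.

Lemma ell2_conj i v w : ell2_form i w v = Num.conj (ell2_form i v w).
Proof.
rewrite /ell2_form rmorph_sum; apply: eq_bigr => y _.
by rewrite rmorphM /= conjCK mulrC.
Qed.

Lemma ell2_ge0 i v : 0 <= Re (ell2_form i v v).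
Proof. by rewrite ell2_formE sumr_ge0// => y _; exact: normsq_ge0. Qed.

Lemma ell2_directed (i j : {s : seq Y | uniq s}) : exists k, forall v, ell2_dom v ->
  Re (ell2_form i v v) <= Re (ell2_form k v v) /\
  Re (ell2_form j v v) <= Re (ell2_form k v v).
Proof.
case: i j => [s us] [r ur]; exists (exist _ (undup (s ++ r)) (undup_uniq _)) => v _.
rewrite !ell2_formE /=; split; apply: ler_sum_uniq_sub; rewrite ?undup_uniq//;
  by [move=> y; exact: normsq_ge0 | move=> y yi; rewrite mem_undup mem_cat yi ?orbT].
Qed.

Lemma ell2_sep v : ell2_dom v -> (forall i, Re (ell2_form i v v) = 0) -> v = 0.
Proof.
move=> _ v0; apply/funext => y; apply: normsq_eq0.
have u1 : uniq [:: y] by [].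
by have := v0 (exist _ [:: y] u1); rewrite ell2_formE big_seq1.
Qed.

Lemma ell2_complete (u : nat -> Y -> R[i]) : (forall n, ell2_dom (u n)) ->
  (forall e : R, 0 < e -> exists N, forall m n, (N <= m)%N -> (N <= n)%N ->
    forall i, Re (ell2_form i (u m - u n) (u m - u n)) <= e) ->
  exists2 v, ell2_dom v & forall i (e : R), 0 < e -> exists N, forall n, (N <= n)%N ->
    Re (ell2_form i (u n - v) (u n - v)) <= e.
Proof.
move=> ud uC.
have /(_ _)/cid-/all_sig[v vP] : forall y, exists z : R[i], forall e : R, 0 < e ->
    exists N, forall n, (N <= n)%N -> normsq (u n y - z) <= e.
  move=> y; apply: complex_cauchy_cvg => e e0.
  have [N NP] := uC e e0; exists N => m n Nm Nn.
  have u1 : uniq [:: y] by [].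
  by have := NP m n Nm Nn (exist _ [:: y] u1); rewrite ell2_formE big_seq1.
exists v.
  move=> y Xy; apply: normsq_eq0; apply/eqP; rewrite eq_le normsq_ge0 andbT.
  apply/ler_addgt0Pl => e e0; rewrite addr0; have [N NP] := vP y e e0.
  by have := NP N (leqnn _); rewrite ud// sub0r normsqN.
move=> [s us] e; elim: s {us}(us) e => [|y s IH] us e e0.
  by exists 0%N => n _; rewrite ell2_formE big_nil ltW.
have us' : uniq s by case/andP: us.
have e2 : 0 < e / 2 by rewrite divr_gt0.
have [N NP] := IH us' _ e2; have [M MP] := vP y _ e2.
exists (maxn N M) => n; rewrite geq_max => /andP[/NP + /MP].
rewrite !ell2_formE big_cons /= => le1 le2.
by rewrite [e]splitr lerD.
Qed.

Definition ell2 : directed_forms (Y -> R[i]) :=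
  @DirectedForms R (Y -> R[i]) ell2_dom {s : seq Y | uniq s} ell2_form
    (exist _ [::] isT) (fun y _ => erefl) ell2_domP ell2_lin ell2_conj ell2_ge0
    ell2_directed ell2_sep ell2_complete.

End SquareSummable.

(** * Finite generation of groups with property (T) *)

Section FiniteGeneration.
Variables (R : realType) (G : groupType) (F : {fset G}) (eps : R).
Hypothesis kazhdan : forall (H : hilbertType R) (rho : G -> H -> H),
  unitary_rep rho ->
  (exists2 x : H, x != 0 &
     forall g, g \in F -> `|rho g x - x| < eps%:C * `|x|) ->
  exists2 y : H, y != 0 & forall g, rho g y = y.
Hypothesis eps_gt0 : 0 < eps.

Let gens : seq G := (F : seq G) ++ [seq g^-1%g | g <- (F : seq G)].

Definition kazhdan_subgroup (g : G) := forall P : G -> Prop,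
  P 1%g -> (forall x y, x \in gens -> P y -> P (x * y)%g) -> P g.
Local Notation H0 := kazhdan_subgroup.

Lemma ksub1 : H0 1%g. Proof. by move=> P P1 _. Qed.

Lemma ksubMg x y : x \in gens -> H0 y -> H0 (x * y)%g.
Proof. by move=> xg Hy P P1 PM; apply: (PM) => //; exact: Hy. Qed.

Lemma ksubM x y : H0 x -> H0 y -> H0 (x * y)%g.
Proof.
move=> Hx Hy; apply: (Hx (fun x => H0 (x * y)%g)) => [|{Hx}x z xg IH]; first by rewrite mul1g.
by rewrite -mulgA; exact: ksubMg.
Qed.

Lemma ksub_gen x : x \in gens -> H0 x.
Proof. by move=> xg; rewrite -[x]mulg1; apply: ksubMg => //; exact: ksub1. Qed.

Lemma gensV x : x \in gens -> x^-1%g \in gens.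
Proof.
rewrite !mem_cat => /orP[xF|/mapP[y yF ->]]; last by rewrite invgK yF.
by rewrite orbC map_f.
Qed.

Lemma ksubV x : H0 x -> H0 x^-1%g.
Proof.
move=> Hx; apply: (Hx (fun x => H0 x^-1%g)) => [|{Hx}x z xg IH].
  by rewrite invg1; exact: ksub1.
by rewrite invMg; apply: ksubM => //; apply: ksub_gen; exact: gensV.
Qed.

Definition coset_set (k : G) : set G := [set x | H0 (k^-1 * x)%g].
(** This is the translate of [A] by the inverse of [g], a right action on sets; composing functions
    with it gives a left action. *)
Definition translate (g : G) (A : set G) : set G := [set x | A (g * x)%g].

Lemma translateM g h A : translate (g * h)%g A = translate h (translate g A).
Proof. by apply/funext => x; rewrite /translate /mkset mulgA. Qed.

Lemma translate1 A : translate 1%g A = A.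
Proof. by apply/funext => x; rewrite /translate /mkset mul1g. Qed.

Lemma translateK g : cancel (translate g) (translate g^-1%g).
Proof. by move=> A; rewrite -translateM mulgV translate1. Qed.

Lemma translate_coset g k : translate g (coset_set k) = coset_set (g^-1 * k)%g.
Proof.
by apply/funext => x; rewrite /translate /coset_set /mkset invMg invgK mulgA.
Qed.

Lemma coset_set_eq g k : H0 (k^-1 * g)%g -> coset_set g = coset_set k.
Proof.
move=> Hkg; apply/seteqP; split => x Hx; rewrite /coset_set /mkset.
  have -> : (k^-1 * x = (k^-1 * g) * (g^-1 * x))%g by rewrite mulgA mulgK.
  exact: ksubM.
have -> : (g^-1 * x = (k^-1 * g)^-1 * (k^-1 * x))%g by rewrite invMg invgK mulgA mulgK.
by apply: ksubM => //; exact: ksubV.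
Qed.

Let X (A : set G) := exists k, A = coset_set k.
Local Notation D := (@ell2 R (set G) X).

(** The indicator of the trivial coset is fixed exactly by [F], so the displacement bound for
    property (T) is 0. *)
Lemma exists_invariant_coset_function : exists w : set G -> R[i],
  [/\ df_dom D w, df_bounded D w, w != 0 & forall g A, w (translate g A) = w A].
Proof.
pose act (g : G) (v : set G -> R[i]) : set G -> R[i] := fun A => v (translate g A).
pose v0 : set G -> R[i] := fun A => (A == coset_set 1%g)%:R.
have X1 : X (coset_set 1%g) by exists 1%g.
have XT g A : X (translate g A) -> X A.
  move=> [k kA]; exists (g * k)%g; apply: (can_inj (translateK g)).
  by rewrite kA translate_coset mulgA mulVg mul1g.
have u1 : uniq [:: coset_set 1%g] by [].
have v0F g : g \in F -> act g v0 = v0.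
  move=> gF; apply/funext => A; rewrite /act /v0; congr (_%:R); congr nat_of_bool.
  have gH : coset_set g = coset_set 1%g.
    by apply: coset_set_eq; rewrite invg1 mul1g; apply: ksub_gen; rewrite mem_cat gF.
  have tH : translate g (coset_set 1%g) = coset_set 1%g.
    by rewrite -{1}gH translate_coset mulVg.
  by rewrite -{1}tH (can_eq (translateK g)).
have v0E : Re (df_form (exist _ [:: coset_set 1%g] u1 : df_idx D) v0 v0) = 1.
  by rewrite ell2_formE big_seq1 /v0 eqxx /normsq /= expr1n expr0n addr0.
have [|||||||||||w [dw bw w0 wA]] := @kazhdan_invariant_vector R G F eps kazhdan eps_gt0 _ D act
  _ _ _ _ _ v0 (exist _ [:: coset_set 1%g] u1) 1 0.
- by move=> g a u v; apply/funext => A.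
- by move=> g v dv A XA; apply: dv => /XT.
- move=> g [s us]; exists (exist _ [seq translate g A | A <- s]
    (etrans (map_inj_uniq (can_inj (translateK g)) s) us)) => v _.
  by rewrite /df_sq !ell2_formE /= big_map.
- by move=> g h v _; apply/funext => A; rewrite /act translateM.
- by move=> v _; apply/funext => A; rewrite /act translate1.
- by move=> A XA; rewrite /v0; case: eqP => // AE; case: XA; rewrite AE.
- exists 1 => -[s us]; rewrite /df_sq ell2_formE /=.
  have [H1s|H1s] := boolP (coset_set 1%g \in s).
    rewrite (bigD1_seq _ H1s us) /= big1 ?addr0; last first.
      by move=> A /negPf A1; rewrite /v0 A1 /normsq /= expr0n addr0.
    by rewrite /v0 eqxx /normsq /= expr1n expr0n addr0.
  rewrite big_seq big1 ?ler01// => A As; rewrite /v0.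
  by case: eqP As => [->|_ _]; rewrite ?(negPf H1s)// /normsq /= expr0n addr0.
- by [].
- by rewrite /df_sq v0E.
- by rewrite mulr1 exprn_gt0.
- move=> g gF [s us]; rewrite v0F// subrr /df_sq ell2_formE big1// => A _.
  by rewrite /normsq /= expr0n addr0.
by exists w; split=> // g A; rewrite -{2}(wA g).
Qed.

(* An invariant square-summable function on the cosets of the subgroup generated
   by the Kazhdan set is constant, so there are finitely many cosets. *)
Lemma property_T_finitely_generated : exists s : seq G, monoid_generated s.
Proof.
have [w [dw [M MP] w0 wT]] := exists_invariant_coset_function.
have [A wA] : exists A, w A != 0.
  apply: contrapT => nA; move/eqP: w0; apply; apply/funext => A.
  by apply: contrapT => wA; apply: nA; exists A; exact/eqP.
have [k Ak] : X A by apply: contrapT => /dw /eqP; rewrite (negPf wA).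
pose c := normsq (w A).
have c0 : 0 < c.
  rewrite lt_def normsq_ge0 andbT; apply/eqP => /normsq_eq0/eqP.
  by rewrite (negPf wA).
have wc h : normsq (w (coset_set h)) = c.
  rewrite /c Ak -(wT (k * h^-1)%g (coset_set k)) translate_coset.
  by rewrite invMg invgK mulgVK.
pose Q n := `[<exists r : seq G, uniq (map coset_set r) /\ size r = n>].
have exQ : exists n, Q n by exists 0%N; apply/asboolP; exists [::].
(* Every coset contributes [c] to a sum bounded by [M]. *)
have ubQ n : Q n -> (n <= (Num.truncn (M / c)).+1)%N.
  move=> /asboolP[r [ur <-]]; have := MP (exist _ (map coset_set r) ur).
  rewrite /df_sq ell2_formE /= big_map (eq_bigr (fun=> c)) => [|h _]; last exact: wc.
  rewrite big_const_seq count_predT iter_addr_0 -mulr_natr mulrC -ler_pdivlMr// => le1.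
  by rewrite -(ler_nat R); apply: le_trans le1 (ltW (truncnS_gt _)).
case: (ex_maxnP exQ ubQ) => n /asboolP[r [ur rn]] nmax.
have rP g : exists2 h, h \in r & coset_set g = coset_set h.
  have [|gr] := boolP (coset_set g \in map coset_set r).
    by move=> /mapP[h hr ->]; exists h.
  have : (n.+1 <= n)%N; last by rewrite ltnn.
  by apply: nmax; apply/asboolP; exists (g :: r); rewrite /= gr rn.
(* Coset representatives followed by the generators of the subgroup: each element is one of the
   former times a word in the latter. *)
exists (r ++ gens) => P P1 PM g.
have [h hr gh] := rP g.
have Hgh : H0 (h^-1 * g)%g.
  have : coset_set g g by rewrite /coset_set /mkset mulVg; exact: ksub1.
  by rewrite gh.
have -> : g = (h * (h^-1 * g))%g by rewrite mulgA mulgV mul1g.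
apply: (PM); first by rewrite mem_cat hr.
by apply: Hgh => // x y xg; apply: PM; rewrite mem_cat xg orbT.
Qed.


End FiniteGeneration.

(** A largest form attains the supremum, and polarization then identifies the inner product with it.
    It makes the inner product of a finite-dimensional [ell2] explicit. *)
Lemma df_dot_top (R : realType) (V : lmodType R[i]) (D : directed_forms V)
    (k : df_idx D) : (forall v, df_dom D v -> forall i : df_idx D, df_sq i v <= df_sq k v) ->
  forall x y : df_space D, dot x y = df_form k (val x) (val y).
Proof.
move=> kP.
have sqE (x : df_space D) : nsq x = df_sq k (val x).
  have dx := df_val_dom x.
  have -> : nsq x = df_Q D (val x) by exact: df_dotxx.
  apply/eqP; rewrite eq_le df_Q_le ?df_Q_ub//; first by have /df_predP[] := valP x.
  by move=> i; exact: kP.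
have reE (x y : df_space D) : Re (dot x y) = Re (df_form k (val x) (val y)).
  have := nsqD x y; rewrite !sqE /df_sq.
  have -> : val (x + y) = val x + val y by [].
  by rewrite (sq_formD (@df_lin _ _ D k) (@df_conj _ _ D k)); lra.
move=> x y; apply: complex_eqP => //.
have := reE x ('i%C *: y).
have -> : val ('i%C *: y) = 'i%C *: val y by [].
rewrite dotZr (formZr (@df_lin _ _ D k) (@df_conj _ _ D k)).
by rewrite !cReM !cRe_conj !cIm_conj /=; lra.
Qed.

Lemma exists_orthonormal_basis (R : realType) (d : nat) :
  exists (H : hilbertType R) (e : 'I_d -> H), orthonormal_basis e.
Proof.
pose D := @ell2 R 'I_d (fun=> True); pose H : hilbertType R := df_space D.
pose k : df_idx D := exist _ (enum 'I_d) (enum_uniq _).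
have kP v : df_dom D v -> forall i : df_idx D, df_sq i v <= df_sq k v.
  move=> _ [s us]; rewrite /df_sq !ell2_formE /=.
  apply: ler_sum_uniq_sub => //; first exact: enum_uniq.
    by move=> i _; rewrite mem_enum.
  by move=> i; exact: normsq_ge0.
have inH v : v \in df_pred D.
  have dv : df_dom D v by move=> i [].
  by apply/df_predP; split=> //; exists (df_sq k v) => i; exact: kP.
pose e i : H := Sub (fun j : 'I_d => (i == j)%:R) (inH _).
exists H, e; split=> [i j|x].
  rewrite (df_dot_top kP) /= /ell2_form big_enum /= (bigD1 i)//= big1 ?addr0.
    by rewrite eqxx mul1r conjC_nat eq_sym.
  by move=> l /negPf li; rewrite eq_sym li mul0r.
exists (val x); apply: val_inj; apply/funext => j.
have valS (r : seq 'I_d) (c : 'I_d -> R[i]) (l : 'I_d) :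
    val (\sum_(i <- r) c i *: e i) l = \sum_(i <- r) c i * (i == l)%:R.
  elim: r => [|i r IH]; first by rewrite !big_nil.
  by rewrite !big_cons -IH.
rewrite valS (bigD1_seq j) ?index_enum_uniq ?mem_index_enum//= eqxx mulr1 big1 ?addr0//.
by move=> i /negPf ij; rewrite ij mulr0.
Qed.

Local Open Scope sesquilinear_scope.

(** * Hyperlinear approximations *)

Section MatrixOperators.
Variable R : realType.

Lemma norm2E (d : nat) (A : 'M[R[i]]_d) :
  norm2 A = Num.sqrt (d%:R^-1 * \sum_i \sum_j normsq (A i j)).
Proof.
rewrite /norm2 /tau; congr Num.sqrt.
have -> : (d%:R : R[i])^-1 = (d%:R^-1)%:C by rewrite fmorphV rmorph_nat.
rewrite cReM /= mul0r subr0; congr (_ * _).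
rewrite /mxtrace cRe_sum exchange_big /=; apply: eq_bigr => j _.
rewrite mxE cRe_sum; apply: eq_bigr => i _.
by rewrite !mxE mulrC mul_conj_normsq.
Qed.

Lemma norm2_ge0 (d : nat) (A : 'M[R[i]]_d) : 0 <= norm2 A.
Proof. exact: sqrtr_ge0. Qed.

Variables (H : hilbertType R) (d : nat) (e : 'I_d -> H).
Hypothesis eB : orthonormal_basis e.

Lemma basis_coord (c : 'I_d -> R[i]) j : dot (\sum_i c i *: e i) (e j) = c j.
Proof.
rewrite dot_suml (bigD1 j)//= dotZl eB.1 eqxx mulr1 big1 ?addr0// => i /negPf ij.
by rewrite dotZl eB.1 ij mulr0.
Qed.

Lemma basis_expand x : x = \sum_i dot x (e i) *: e i.
Proof.
have [c xc] := eB.2 x; rewrite [LHS]xc; apply: eq_bigr => i _.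
by rewrite xc basis_coord.
Qed.

Lemma basis_dot x y : dot x y = \sum_i dot x (e i) * Num.conj (dot y (e i)).
Proof.
rewrite [in LHS](basis_expand y) dot_sumr; apply: eq_bigr => i _.
by rewrite dotZr mulrC.
Qed.

Definition mx_operator (M : 'M[R[i]]_d) (x : H) : H :=
  \sum_i (\sum_j M i j * dot x (e j)) *: e i.

Lemma mx_operator_coord M x i : dot (mx_operator M x) (e i) = \sum_j M i j * dot x (e j).
Proof. exact: basis_coord. Qed.

Lemma mx_operator_linear M : linear (mx_operator M).
Proof.
move=> a x y; rewrite /mx_operator scaler_sumr -big_split; apply: eq_bigr => i _ /=.
rewrite scalerA -scalerDl; congr (_ *: _); rewrite mulr_sumr -big_split.
by apply: eq_bigr => j _ /=; rewrite dot_lin; ring.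
Qed.

Lemma mx_operatorM M N x : mx_operator M (mx_operator N x) = mx_operator (M *m N) x.
Proof.
apply: eq_bigr => i _; congr (_ *: _).
under eq_bigr => j _ do rewrite mx_operator_coord mulr_sumr.
rewrite exchange_big; apply: eq_bigr => k _ /=; rewrite mxE mulr_suml.
by apply: eq_bigr => j _; rewrite mulrA.
Qed.

Lemma mx_operator1 x : mx_operator 1%:M x = x.
Proof.
rewrite [RHS]basis_expand; apply: eq_bigr => i _; congr (_ *: _).
rewrite (bigD1 i)//= mxE eqxx mul1r big1 ?addr0// => j /negPf ij.
by rewrite mxE eq_sym ij mul0r.
Qed.

Lemma mxop_mx_operator M : mxop e (mx_operator M) = M.
Proof.
apply/matrixP => i j; rewrite mxE mx_operator_coord (bigD1 j)//= eB.1 eqxx mulr1.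
by rewrite big1 ?addr0// => k /negPf kj; rewrite eB.1 eq_sym kj mulr0.
Qed.

Lemma mx_operatorB M N : mx_operator M \- mx_operator N = mx_operator (M - N).
Proof.
apply/funext => x /=; rewrite /mx_operator -sumrB; apply: eq_bigr => i _.
rewrite -scalerBl; congr (_ *: _); rewrite -sumrB; apply: eq_bigr => j _.
by rewrite !mxE; ring.
Qed.

Lemma mx_operator_dot M x y : dot (mx_operator M x) y = dot x (mx_operator (M ^t*) y).
Proof.
rewrite basis_dot [RHS]basis_dot.
under eq_bigr => i _ do rewrite mx_operator_coord mulr_suml.
rewrite exchange_big; apply: eq_bigr => j _ /=.
rewrite mx_operator_coord rmorph_sum mulr_sumr; apply: eq_bigr => i _ /=.
by rewrite !mxE rmorphM /= conjCK; ring.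
Qed.

Lemma unitarymx_operator M : M \is unitarymx -> unitary (mx_operator M).
Proof.
move=> /unitarymxP MU; have MU' := mulmx1C MU; split.
- exact: mx_operator_linear.
- by move=> x y; rewrite mx_operator_dot mx_operatorM MU' mx_operator1.
- by move=> y; exists (mx_operator (M ^t*) y); rewrite mx_operatorM MU mx_operator1.
Qed.

End MatrixOperators.

Section Approximation.
Variables (R : realType) (G : groupType).
Hypothesis G_countable : countable [set: G].
Hypothesis G_hyperlinear : hyperlinear R G.

Lemma exists_finite_exhaustion : exists F : nat -> {fset G},
  forall g, exists N, forall n, (N <= n)%N -> g \in F n.
Proof.
have /countable_injP[f finj] := G_countable.
pose h k : option G :=
  if pselect (exists g, f g = k) is left p then Some (projT1 (cid p)) else None.
exists (fun n => [fset g in pmap h (iota 0 n)]%fset) => g.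
exists (f g).+1 => n gn; rewrite inE /= mem_pmap; apply/mapP.
exists (f g); first by rewrite mem_iota.
rewrite /h; case: pselect => [p|[]]; last by exists g.
by case: cid => g' /= fg; congr Some; apply: finj; rewrite ?inE.
Qed.

Lemma cvg_squeeze0 (u : nat -> R) (N : nat) : (forall n, 0 <= u n) ->
  (forall n, (N <= n)%N -> u n <= n.+1%:R^-1) -> u @ \oo --> (0 : R).
Proof.
move=> u0 uN; apply/cvgrPdist_le => eps eps0.
have [M MP] := invS_eventually_le eps0.
exists (maxn N M) => // n /=.
rewrite geq_max => /andP[Nn /MP Mn]; rewrite sub0r normrN ger0_norm//.
exact: le_trans (uN n Nn) Mn.
Qed.

Lemma limn_einf_ge (u : nat -> R) (l : R) (N : nat) :
  (forall n, (N <= n)%N -> l - n.+1%:R^-1 <= u n) ->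
  (l%:E <= limn_einf (fun n => (u n)%:E))%E.
Proof.
move=> uN; rewrite limn_einf_lim (cvg_lim _ (@cvg_einfs_sup _ _))//.
apply/lee_addgt0Pr => eps eps0.
have [K /(_ K (leqnn _)) KP] := invS_eventually_le eps0.
pose m := maxn N K.
apply: (@le_trans _ _ (einfs (fun n => (u n)%:E) m + eps%:E)%E); last first.
  by rewrite leeD2r//; apply: ereal_sup_ubound; exists m.
rewrite -leeBlDr// -EFinB; apply: le_ereal_inf_tmp => _ [k /= mk <-].
rewrite lee_fin; apply: le_trans (uN k _); last exact: leq_trans (leq_maxl _ _) mk.
rewrite lerB//; apply: le_trans KP; rewrite lef_pV2 ?posrE// ler_nat ltnS.
exact: leq_trans (leq_maxr _ _) mk.
Qed.

Lemma exists_hyperlinear_approximation : exists (H : nat -> hilbertType R)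
  (d : nat -> nat) (e : forall n, 'I_(d n) -> H n) (phi : forall n, G -> H n -> H n),
  hyperlinear_approximation e phi.
Proof.
have [F FP] := exists_finite_exhaustion.
have /(_ _)/cid-/all_sig[d /(_ _)/cid-/all_sig[p pP]] := fun n : nat =>
  G_hyperlinear (ltac:(by rewrite invr_gt0) : (0 : R) < n.+1%:R^-1) (F n).
have /(_ _)/cid-/all_sig[H /(_ _)/cid-/all_sig[e eB]] :=
  fun n => exists_orthonormal_basis R (d n).
(* Nothing is known of [p n] outside [F n]; the identity keeps every [phi n g] unitary, and a fixed
   [g] lies in [F n] for all large [n]. *)
pose M n g : 'M[R[i]]_(d n) := if g \in F n then p n g else 1%:M.
pose phi n g : H n -> H n := mx_operator (e n) (M n g).
have ME n g : g \in F n -> M n g = p n g by rewrite /M => ->.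
exists H, d, e, phi; split.
- by move=> n; split=> //; case: (pP n).
- move=> n g; apply: unitarymx_operator => //; rewrite /M; case: ifP => gF.
    by case: (pP n) => _ + _ _; apply.
  by apply/unitarymxP; rewrite trmx1 map_mx1 mulmx1.
- move=> g h; have [N1 P1] := FP g; have [N2 P2] := FP h; have [N3 P3] := FP (g * h)%g.
  apply: (@cvg_squeeze0 _ (maxn N1 (maxn N2 N3))) => [n|n]; first exact: norm2_ge0.
  rewrite !geq_max => /and3P[/P1 gF /P2 hF /P3 ghF].
  have -> : (phi n g \o phi n h) \- phi n (g * h)%g =
      mx_operator (e n) (p n g *m p n h - p n (g * h)%g).
    rewrite -(mx_operatorB (e n)) -!ME//; apply/funext => x /=.
    by rewrite /phi (mx_operatorM (eB n)).
  rewrite /norm2op (mxop_mx_operator (eB n)).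
  by case: (pP n) => _ _ + _ => /(_ g h gF hF ghF)/ltW.
- move=> g g1; have [N P] := FP g.
  apply: (@limn_einf_ge _ _ N) => n /P gF.
  have -> : phi n g \- id = mx_operator (e n) (p n g - 1%:M).
    rewrite -(mx_operatorB (e n)) -ME//; apply/funext => x /=.
    by rewrite (mx_operator1 (eB n)).
  rewrite /norm2op (mxop_mx_operator (eB n)).
  by case: (pP n) => _ _ _ => /(_ g gF g1)/ltW.
Qed.

End Approximation.

(** * Compressions of unitary representations *)

Section OrthonormalFamilies.
Variables (R : realType) (K : hilbertType R).

Lemma parseval (s : seq K) x : proj s x = x ->
  \sum_(f <- s) normsq (dot x f) = nsq x.
Proof.
move=> px; have -> : nsq x = Re (dot x (proj s x)) by rewrite px.
rewrite dot_proj_eq cRe_sum.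
by apply: eq_bigr => f _; rewrite mul_conj_normsq.
Qed.

Lemma ons_family (I : eqType) (f : I -> K) (r : seq I) :
  (forall i j, dot (f i) (f j) = (i == j)%:R) -> uniq r -> ons (map f r).
Proof.
move=> fd; elim: r => [//|i r IH] /= /andP[ir ur]; split; last exact: IH.
  by rewrite /nsq fd eqxx.
by move=> _ /mapP[j jr ->]; rewrite fd; case: eqP ir => // ->; rewrite jr.
Qed.

Lemma ons_nth (s : seq K) i j : ons s -> (i < size s)%N -> (j < size s)%N ->
  dot (nth 0 s i) (nth 0 s j) = (i == j)%:R.
Proof.
elim: s i j => [//|x s IH] [|i] [|j] /= [x1 xs os] si sj.
- by rewrite dotxx x1.
- by rewrite xs// mem_nth.
- by rewrite dotC xs ?mem_nth// rmorph0.
- by rewrite IH.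
Qed.

Lemma nsq_orthonormal_sum (I : finType) (f : I -> K) (c : I -> R[i]) :
  (forall i j, dot (f i) (f j) = (i == j)%:R) ->
  nsq (\sum_i c i *: f i) = \sum_i normsq (c i).
Proof.
move=> fd; rewrite /nsq dot_suml cRe_sum; apply: eq_bigr => i _.
rewrite dotZl dot_sumr (bigD1 i)//= big1 ?addr0 => [|j /negPf ji].
  by rewrite dotZr fd eqxx mulr1 mul_conj_normsq.
by rewrite dotZr fd eq_sym ji mulr0.
Qed.

End OrthonormalFamilies.

Section UnitaryRepresentations.
Variables (R : realType) (G : groupType) (K : hilbertType R) (rho : G -> K -> K).
Hypothesis rho_rep : unitary_rep rho.

Lemma rep_linear g : linear (rho g). Proof. by case: (rho_rep.1 g). Qed.

Lemma rep_dot g x y : dot (rho g x) (rho g y) = dot x y.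
Proof. by case: (rho_rep.1 g) => _ + _; apply. Qed.

Lemma rep_nsq g x : nsq (rho g x) = nsq x. Proof. by rewrite /nsq rep_dot. Qed.

Lemma repM g h x : rho (g * h)%g x = rho g (rho h x).
Proof. by rewrite rho_rep.2. Qed.

Lemma rep1 x : rho 1%g x = x.
Proof.
have [_ _ /(_ x)[y <-]] := rho_rep.1 1%g.
by rewrite -repM mulg1.
Qed.

Lemma repK g x : rho g^-1%g (rho g x) = x.
Proof. by rewrite -repM mulVg rep1. Qed.

Lemma repVK g x : rho g (rho g^-1%g x) = x.
Proof. by rewrite -repM mulgV rep1. Qed.

Lemma rep_dotV g x y : dot (rho g^-1%g x) y = dot x (rho g y).
Proof. by rewrite -[in LHS](repK g y) rep_dot. Qed.

Variables (s : seq K) (os : ons s).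
Hypothesis s_stable : forall g f, f \in s -> proj s (rho g f) = rho g f.

Definition subrep_mx (g : G) : 'M[R[i]]_(size s) :=
  \matrix_(i, j) dot (rho g (nth 0 s j)) (nth 0 s i).

Lemma rep_expand g (j : 'I_(size s)) :
  rho g (nth 0 s j) = \sum_(k < size s) subrep_mx g k j *: nth 0 s k.
Proof.
rewrite -s_stable ?mem_nth// /proj (big_nth 0) big_mkord.
by apply: eq_bigr => k _; rewrite mxE.
Qed.

Lemma subrep_mx1 : subrep_mx 1%g = 1%:M.
Proof.
by apply/matrixP => i j; rewrite !mxE rep1 ons_nth// eq_sym.
Qed.

Lemma subrep_mxM g h : subrep_mx (g * h)%g = subrep_mx g *m subrep_mx h.
Proof.
apply/matrixP => i j; rewrite !mxE repM rep_expand (linear_map_sum (rep_linear g)) dot_suml.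
apply: eq_bigr => k _.
by rewrite (linear_mapZ (rep_linear g)) dotZl mxE mulrC mxE.
Qed.

Lemma subrep_mx_trivial h f : subrep_mx h = 1%:M -> f \in s -> rho h f = f.
Proof.
move=> h1 /(nthP 0)[j js <-]; have := rep_expand h (Ordinal js); rewrite /= => ->.
rewrite h1 (bigD1 (Ordinal js))//= mxE eqxx scale1r big1 ?addr0// => k /negPf kj.
by rewrite mxE kj scale0r.
Qed.

End UnitaryRepresentations.

Section FiniteResidual.
Variable G : groupType.

Definition finite_residual (h : G) :=
  forall (Q : finGroupType) (f : {multiplicative G -> Q}), f h = 1%g.

(** Normality of the residual, which makes its fixed vectors a subrepresentation. *)
Lemma finite_residualJ h g : finite_residual h -> finite_residual (g^-1 * h * g)%g.
Proof.
move=> hN Q f; have f1 : f 1%g = 1%g.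
  by apply: (mulgI (f 1%g)); rewrite -gmulfM !mulg1.
by rewrite !gmulfM hN mulg1 -gmulfM mulVg.
Qed.

End FiniteResidual.

(** * Operators that commute with the representation *)

Section KeyLemma.
Variables (R : realType) (G : groupType) (F : {fset G}) (eps : R).
Hypothesis kazhdan : forall (H : hilbertType R) (rho : G -> H -> H),
  unitary_rep rho ->
  (exists2 x : H, x != 0 &
     forall g, g \in F -> `|rho g x - x| < eps%:C * `|x|) ->
  exists2 y : H, y != 0 & forall g, rho g y = y.
Hypothesis eps_gt0 : 0 < eps.
Variables (gens : seq G) (K : hilbertType R) (rho : G -> K -> K).
Hypothesis gensP : monoid_generated gens.
Hypothesis rho_rep : unitary_rep rho.

Let rl g := rep_linear rho_rep g.

Definition residual_fixed (x : K) := forall h, finite_residual h -> rho h x = x.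
Local Notation W := residual_fixed.

Lemma residual_fixed0 : W 0.
Proof. by move=> h _; rewrite (linear_map0 (rl h)). Qed.

Lemma residual_fixedP t u v : W u -> W v -> W (t *: u + v).
Proof. by move=> Wu Wv h hN; rewrite rl Wu// Wv. Qed.

Lemma residual_fixed_rep g x : W x -> W (rho g x).
Proof.
move=> Wx h hN; have := Wx _ (finite_residualJ g hN).
by rewrite !(repM rho_rep) => /(congr1 (rho g)); rewrite (repVK rho_rep).
Qed.

Lemma residual_fixed_closed (z : nat -> K) v : (forall n, W (z n)) ->
  (forall e : R, 0 < e -> exists N, forall n, (N <= n)%N -> nsq (z n - v) <= e) -> W v.
Proof.
move=> Wz zv h hN; apply/eqP; rewrite -subr_eq0; apply/eqP/nsq_eq0.
apply/eqP; rewrite eq_le nsq_ge0 andbT; apply/ler_addgt0Pl => e e0; rewrite addr0.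
have [N /(_ N (leqnn _)) NP] := zv (e / 4) (divr_gt0 e0 (ltr0Sn _ _)).
have -> : rho h v - v = - (rho h (z N - v)) + (z N - v).
  by rewrite (linear_mapB (rl h)) (Wz N h hN) opprB addrA subrK.
have := nsqD_le (- rho h (z N - v)) (z N - v); rewrite nsqN (rep_nsq rho_rep); lra.
Qed.

Lemma no_residual_invariant (T : K -> K) (M : R) : linear T ->
  (forall x, W x -> T x = 0) -> (forall s, ons s -> hs_sq s T <= M) ->
  (forall g x, T (rho g x) = rho g (T x)) -> T = 0.
Proof.
move=> Tl TW TM Trho; apply/eqP/negPn/negP => T0.
have [x Tx] : exists x, T x != 0.
  apply: contrapT => nx; move/eqP: T0; apply; apply/funext => x.
  by apply: contrapT => Tx; apply: nx; exists x; exact/eqP.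
have [s [os s0 sT sU]] := top_eigenspace_ons Tl TM Tx.
have stab g f : f \in s -> proj s (rho g f) = rho g f.
  by apply: sU; [exact: rep_nsq|move=> y; exact: Trho].
have [f fs] : exists f, f \in s.
  by case: s s0 {os sT sU stab} => [//|f s] _; exists f; exact: mem_head.
have /negP := sT f fs; apply; apply/eqP/TW => h hN.
apply: (subrep_mx_trivial stab) => //; apply/eqP/negPn/negP => Mh.
have [Q [phi]] := malcev gensP (subrep_mx1 rho_rep os) (subrep_mxM rho_rep stab) Mh.
by rewrite hN eqxx.
Qed.

End KeyLemma.

(** * Almost invariance of P Q under conjugation *)

Section CompressionContradiction.
Variables (R : realType) (G : groupType) (F : {fset G}) (eps : R).
Hypothesis kazhdan : forall (H : hilbertType R) (rho : G -> H -> H),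
  unitary_rep rho ->
  (exists2 x : H, x != 0 &
     forall g, g \in F -> `|rho g x - x| < eps%:C * `|x|) ->
  exists2 y : H, y != 0 & forall g, rho g y = y.
Hypothesis eps_gt0 : 0 < eps.
Variables (gens : seq G) (K : hilbertType R) (rho : G -> K -> K).
Hypothesis gensP : monoid_generated gens.
Hypothesis rho_rep : unitary_rep rho.
Variables (d : nat) (eb : 'I_d -> K).
Hypothesis eb_on : forall i j, dot (eb i) (eb j) = (i == j)%:R.

Local Notation W := (residual_fixed rho).
Let rl g := rep_linear rho_rep g.

Definition compression (g : G) : 'M[R[i]]_d := \matrix_(i, j) dot (rho g (eb j)) (eb i).

Variables (g0 : G) (b : R).
Hypothesis g0N : finite_residual g0.
Hypothesis b_bound : forall g, g \in F ->
  2 * (d%:R - \sum_i \sum_j normsq (compression g i j)) <= b.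
Variable m : R.
Hypothesis m_gt0 : 0 < m.
Hypothesis b_small : b < eps ^+ 2 * m.
Hypothesis m_bound : 4 * m <= \sum_i \sum_j normsq ((compression g0 - 1%:M) i j).

(** The left side of [b_bound] is the squared distance of the two rank [d] projections P and rho(g)
    P rho(g)^* in Hilbert-Schmidt norm, P being the projection onto the span of [eb]. The factor 4
    in [m_bound] pays for || rho(g0) x - x ||^2 <= 4 || x ||^2. *)
Lemma compression_contradiction : False.
Proof.
have /(_ _)/cid-/all_sig[om omP] : forall i, exists z, W z /\
    forall z', W z' -> dot (eb i - z) z' = 0 :> R[i].
  move=> i; have [z Wz zP] := projection_theorem (residual_fixed0 rho_rep)
    (residual_fixedP rho_rep) (residual_fixed_closed rho_rep) (eb i).
  by exists z.
have omW i : W (om i) by case: (omP i).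
pose eta i := eb i - om i.
have etaW i z : W z -> dot (eta i) z = 0 by case: (omP i) => _; apply.
have ebE i : eb i = eta i + om i by rewrite subrK.
pose D := hilbert_schmidt W.
pose act g (T : K -> K) : K -> K := fun x => rho g (T (rho g^-1%g x)).
(* This is P Q, because [eta i] is the image of [eb i] under Q. *)
pose T0 : K -> K := fun x => \sum_i dot x (eta i) *: eb i.
have T0l : linear T0.
  move=> a x y; rewrite /T0 scaler_sumr -big_split; apply: eq_bigr => i _ /=.
  by rewrite dot_lin scalerDl scalerA.
have T0d : df_dom D T0.
  split=> // x Wx; rewrite /T0 big1// => i _.
  by rewrite dotC etaW// rmorph0 scale0r.
have T0b : df_bounded D T0.
  exists (fr_sq [seq (eb i, eta i) | i <- enum 'I_d]) => -[s os].
  rewrite /df_sq hs_formE /= /hs_sq.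
  apply: le_trans (fr_sq_bound _ os); apply: ler_sum => f _.
  by rewrite big_map big_enum.
have T0m : exists i : df_idx D, m <= df_sq i T0.
  have [t ot tP] := @gram_schmidt _ K [::] [seq eta i | i <- enum 'I_d] I.
  rewrite cats0 in ot tP.
  exists (exist _ t ot); rewrite /df_sq hs_formE /= /hs_sq.
  under eq_bigr => f _ do rewrite (nsq_orthonormal_sum _ eb_on).
  rewrite exchange_big /=.
  have -> : \sum_i \sum_(f <- t) normsq (dot f (eta i)) = \sum_i nsq (eta i).
    apply: eq_bigr => i _; rewrite -(parseval (tP _ _)); last by rewrite map_f ?mem_enum.
    apply: eq_bigr => f _.
    by rewrite (dotC (eta i) f) /normsq cRe_conj cIm_conj sqrrN.
  have : 4 * m <= 4 * \sum_i nsq (eta i); last by lra.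
  apply: le_trans m_bound _; rewrite exchange_big mulr_sumr /=; apply: ler_sum => j _.
  (* As [rho g0] fixes [om j], column [j] consists of the coefficients of [rho g0 (eta j) - eta j]
     along [eb]. *)
  have -> : \sum_i normsq ((compression g0 - 1%:M) i j) =
      \sum_(f <- [seq eb i | i <- enum 'I_d]) normsq (dot (rho g0 (eta j) - eta j) f).
    rewrite big_map big_enum /=; apply: eq_bigr => i _; congr normsq.
    rewrite !mxE eq_sym -eb_on -dotBl ebE (linear_mapD (rl g0)) (omW j g0 g0N).
    by rewrite opprD addrACA subrr addr0.
  apply: le_trans (bessel _ (ons_family eb_on (enum_uniq _))) _.
  have := nsqD_le (rho g0 (eta j)) (- eta j); rewrite nsqN (rep_nsq rho_rep); lra.
have boolE (V : nmodType) (f : bool * 'I_d -> V) :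
    \sum_k f k = \sum_i (f (true, i) + f (false, i)).
  rewrite (eq_bigr (fun k => f (k.1, k.2))) => [|[a i]//].
  by rewrite -(pair_bigA _ (fun a i => f (a, i))) big_bool big_split.
(* [act g T0 - T0] is the finite rank operator given by [L eta].  Since the vectors
   [B eta _] and [B om _] are orthogonal, its norm is at most that of [L eb], the
   commutator defect of the whole projection onto the span of [eb]. *)
have T0g g : g \in F -> forall i : df_idx D, df_sq i (act g T0 - T0) <= b.
  move=> gF [s os]; rewrite /df_sq hs_formE /= /hs_sq.
  pose U (k : bool * 'I_d) := if k.1 then rho g (eb k.2) else - eb k.2.
  pose B (v : 'I_d -> K) (k : bool * 'I_d) := if k.1 then rho g (v k.2) else v k.2.
  pose L v := [seq (U k, B v k) | k <- enum {: bool * 'I_d}].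
  have LE v : fr_sq (L v) = Re (\sum_k \sum_l dot (U k) (U l) * dot (B v l) (B v k)).
    rewrite /fr_sq big_map big_enum /=; congr (complex.Re _); apply: eq_bigr => k _.
    by rewrite big_map big_enum.
  have Lsplit : fr_sq (L eb) = fr_sq (L eta) + fr_sq (L om).
    rewrite !LE -cReD -big_split; congr (complex.Re _); apply: eq_bigr => k _ /=.
    rewrite -big_split; apply: eq_bigr => l _ /=; rewrite -mulrDr; congr (_ * _).
    have Bom i : W (B om i).
      by rewrite /B; case: i.1; [exact: residual_fixed_rep|exact: omW].
    have Beta i z : W z -> dot (B eta i) z = 0.
      move=> Wz; rewrite /B; case: i.1; last exact: etaW.
      rewrite -[g]invgK (rep_dotV rho_rep); apply: etaW.
      exact: residual_fixed_rep.
    have BE i : B eb i = B eta i + B om i.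
      by rewrite /B; case: i.1; rewrite ebE ?(linear_mapD (rl g)).
    rewrite !BE dotDl !dotDr (Beta l _ (Bom k)) (dotC (B eta k) (B om l)).
    rewrite (Beta k _ (Bom l)) rmorph0.
    by rewrite addr0 add0r.
  have Lb : fr_sq (L eb) <= b.
    apply: le_trans (b_bound gF); rewrite LE.
    rewrite le_eqVlt; apply/orP; left; apply/eqP.
    rewrite boolE cRe_sum.
    pose c i j := normsq (compression g i j).
    (* For each pair [(i, j)] the two diagonal blocks of the double sum give [(i == j)] twice, and
       the mixed blocks subtract [c i j] and [c j i]. *)
    have -> : 2 * (d%:R - \sum_i \sum_j normsq (compression g i j)) =
        \sum_i \sum_j ((2 * (i == j)%:R - c i j) - c j i).
      have dE : d%:R = \sum_(i < d) \sum_(j < d) (i == j)%:R :> R.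
        rewrite -[d in LHS]card_ord -sum1_card natr_sum; apply: eq_bigr => i _.
        by rewrite (bigD1 i)//= eqxx big1 ?addr0// => j /negPf ji; rewrite eq_sym ji.
      have cE : \sum_i \sum_j c j i = \sum_i \sum_j c i j by rewrite exchange_big.
      under [RHS]eq_bigr => i _ do rewrite !sumrB -mulr_sumr.
      by rewrite !sumrB -mulr_sumr -dE cE; ring.
    apply: eq_bigr => i _; rewrite !boolE -big_split cRe_sum; apply: eq_bigr => j _ /=.
    rewrite /U /B /= !dotNl !dotNr opprK !(rep_dot rho_rep) !eb_on.
    rewrite (dotC (rho g (eb i)) (eb j)) (dotC (rho g (eb j)) (eb i)).
    have -> : c i j = normsq (dot (rho g (eb j)) (eb i)) by rewrite /c mxE.
    have -> : c j i = normsq (dot (rho g (eb i)) (eb j)) by rewrite /c mxE.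
    rewrite eq_sym.
    case: eqP => _; rewrite /normsq !(cReD, cReN, cImN, cReM, cRe_conj, cIm_conj) /=; ring.
  apply: le_trans Lb; rewrite Lsplit.
  have := fr_sq_ge0 (L om) => Lom.
  apply: le_trans (_ : fr_sq (L eta) <= _); last by rewrite lerDl.
  apply: le_trans (fr_sq_bound _ os); apply: ler_sum => f _.
  rewrite le_eqVlt; apply/orP; left; apply/eqP; congr nsq.
  rewrite big_map big_enum /=.
  rewrite boolE big_split /=.
  change ((act g T0 - T0) f) with (rho g (T0 (rho g^-1%g f)) - T0 f).
  rewrite /T0 (linear_map_sum (rl g)) -sumrN; congr (_ + _); apply: eq_bigr => i _.
    by rewrite (linear_mapZ (rl g)) (rep_dotV rho_rep).
  by rewrite scalerN.
have [i0 i0P] := T0m.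
have [|||||T [[Tl TW] [M TM] Tn0 Tinv]] := @kazhdan_invariant_vector R G F eps kazhdan eps_gt0
  _ D act _ _ _ _ _ T0 i0 m b T0d T0b m_gt0 i0P b_small T0g.
- move=> g a S T; apply/funext => x.
  by change (rho g (a *: S (rho g^-1%g x) + T (rho g^-1%g x)) =
     a *: rho g (S (rho g^-1%g x)) + rho g (T (rho g^-1%g x))); rewrite (rl g).
- move=> g T [Tl TW]; split.
    by move=> a x y; rewrite /act (rl g^-1%g) Tl (rl g).
  by move=> x Wx; rewrite /act TW ?(linear_map0 (rl g))//; exact: residual_fixed_rep.
- move=> g [s os].
  have os' : ons (map (rho g^-1%g) s).
    elim: s os => [//|x s IH] /= [x1 xs os]; split.
    + by rewrite (rep_nsq rho_rep).
    + by move=> _ /mapP[y ys ->]; rewrite (rep_dot rho_rep) xs.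
    + exact: IH.
  exists (exist _ _ os') => T _; rewrite /df_sq !hs_formE /= /hs_sq big_map.
  by apply: ler_sum => f _; rewrite /act (rep_nsq rho_rep).
- move=> g h T [Tl _]; apply/funext => x.
  by rewrite /act invMg !(repM rho_rep).
- by move=> T _; apply/funext => x; rewrite /act invg1 !(rep1 rho_rep).
move/eqP: Tn0; apply; apply: (no_residual_invariant gensP rho_rep Tl TW (M := M)).
  by move=> s os; have := TM (exist _ s os); rewrite /df_sq hs_formE.
move=> g x; rewrite -{1}(Tinv g) /act (repK rho_rep)//.
Qed.

End CompressionContradiction.

(** * Numerical estimates and the conclusion *)

Section Estimates.
Variable R : realType.

(** The weight keeps the coefficient of the main term close to 1. With the factor 2 of the
    parallelogram bound, compressions could not be shown to have nearly full norm. *)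
Lemma normsqD_weighted (t : R) (z w : R[i]) : 0 < t ->
  normsq (z + w) <= (1 + t) * normsq z + (1 + t^-1) * normsq w.
Proof.
move=> t0; rewrite /normsq cReD cImD.
have weighted (x y : R) : (x + y) ^+ 2 <= (1 + t) * x ^+ 2 + (1 + t^-1) * y ^+ 2.
  rewrite -subr_ge0.
  have -> : (1 + t) * x ^+ 2 + (1 + t^-1) * y ^+ 2 - (x + y) ^+ 2 = t^-1 * (t * x - y) ^+ 2.
    by field; rewrite gt_eqF.
  by rewrite mulr_ge0 ?sqr_ge0// invr_ge0 ltW.
have := weighted (Re z) (Re w); have := weighted (Im z) (Im w); lra.
Qed.

Definition entry_sq (d : nat) (A : 'M[R[i]]_d) : R := \sum_i \sum_j normsq (A i j).

Lemma entry_sq_weighted (d : nat) (t : R) (A B : 'M[R[i]]_d) : 0 < t ->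
  entry_sq (A + B) <= (1 + t) * entry_sq A + (1 + t^-1) * entry_sq B.
Proof.
move=> t0; rewrite /entry_sq !mulr_sumr -big_split; apply: ler_sum => i _ /=.
rewrite !mulr_sumr -big_split; apply: ler_sum => j _ /=.
by rewrite mxE normsqD_weighted.
Qed.

Lemma entry_sq_ge0 (d : nat) (A : 'M[R[i]]_d) : 0 <= entry_sq A.
Proof. by do 2!apply: sumr_ge0 => ? _; exact: normsq_ge0. Qed.

Lemma norm2_sqr (d : nat) (A : 'M[R[i]]_d) : (0 < d)%N ->
  norm2 A ^+ 2 * d%:R = entry_sq A.
Proof.
move=> d0; have dR : 0 < d%:R :> R by rewrite ltr0n.
rewrite norm2E sqr_sqrtr; last by rewrite mulr_ge0 ?invr_ge0 ?(ltW dR)// entry_sq_ge0.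
by rewrite mulrC mulrA mulfV ?mul1r// gt_eqF.
Qed.

Lemma norm2_le (d : nat) (A : 'M[R[i]]_d) (t : R) : (0 < d)%N ->
  norm2 A <= t -> entry_sq A <= t ^+ 2 * d%:R.
Proof.
move=> d0 At; rewrite -norm2_sqr// ler_wpM2r// ler_sqr ?nnegrE ?norm2_ge0//.
exact: le_trans (norm2_ge0 _) At.
Qed.

Lemma norm2_ge1 (d : nat) (A : 'M[R[i]]_d) : (0 < d)%N ->
  1 <= norm2 A -> d%:R <= entry_sq A.
Proof.
move=> d0 A1; rewrite -norm2_sqr// -[leLHS]mul1r ler_wpM2r//.
by rewrite -[1](expr1n _ 2) ler_sqr ?nnegrE ?norm2_ge0.
Qed.

Lemma mxopB (H : hilbertType R) (d : nat) (e : 'I_d -> H) (S T : H -> H) :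
  mxop e (S \- T) = mxop e S - mxop e T.
Proof. by apply/matrixP => i j; rewrite !mxE dotBl. Qed.

Lemma entry_sq_unitary (H : hilbertType R) (d : nat) (e : 'I_d -> H) (u : H -> H) :
  orthonormal_basis e -> unitary u -> entry_sq (mxop e u) = d%:R.
Proof.
move=> eB [_ ud _]; rewrite /entry_sq exchange_big /=.
rewrite -[d in RHS]card_ord -sum1_card natr_sum; apply: eq_bigr => j _.
have -> : 1%:R = nsq (u (e j)) by rewrite /nsq ud eB.1 eqxx.
rewrite /nsq (basis_dot eB) cRe_sum; apply: eq_bigr => i _.
by rewrite mxE mul_conj_normsq.
Qed.

Lemma cvg0_eventually_le (u : nat -> R) (t : R) : 0 < t -> u @ \oo --> (0 : R) ->
  exists N, forall n, (N <= n)%N -> u n <= t.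
Proof.
move=> t0 /cvgrPdist_le/(_ _ t0)[N _ NP]; exists N => n /NP /=.
by rewrite sub0r normrN; exact: le_trans (ler_norm _).
Qed.

Lemma limn_einf_eventually (u : nat -> R) (l : R) :
  (l%:E < limn_einf (fun n => (u n)%:E))%E -> exists N, forall n, (N <= n)%N -> l <= u n.
Proof.
rewrite limn_einf_lim (cvg_lim _ (@cvg_einfs_sup _ _))//.
move=> /ereal_sup_gt[_ [N _ <-] lN]; exists N => n Nn.
rewrite -lee_fin; apply: ltW; apply: lt_le_trans lN _.
by apply: ereal_inf_lbound; exists n.
Qed.

Lemma eventually_all (I : eqType) (s : seq I) (p : I -> nat -> Prop) :
  (forall i, exists N, forall n, (N <= n)%N -> p i n) ->
  exists N, forall n, (N <= n)%N -> forall i, i \in s -> p i n.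
Proof.
move=> pP; elim: s => [|i s [N NP]]; first by exists 0%N.
have [M MP] := pP i; exists (maxn N M) => n.
rewrite geq_max => /andP[/NP sP /MP iP] j.
by rewrite inE => /predU1P[->|/sP].
Qed.

End Estimates.

Theorem proposition1p11 (R : realType) (G : groupType)
  (G_countable : countable [set: G]%classic)
  (G_hyperlinear : hyperlinear R G)
  (G_T : property_T R G)
  (G_stable : weakly_ucp_stable R G) :
  residually_finite G.
Proof.
move=> g0 g01; apply: contrapT => g0N.
have {}g0N : finite_residual g0.
  by move=> Q f; apply: contrapT => fg0; apply: g0N; exists Q, f; exact/eqP.
have [F [eps [eps0 kazhdan]]] := G_T.
have [gens gensP] := property_T_finitely_generated kazhdan eps0.
have [H [d [e [phi A]]]] := exists_hyperlinear_approximation G_countable G_hyperlinear.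
have [K [iota [P [rho [iotaD Pproj rho_rep stable]]]]] := G_stable H d e phi A.
have [A1 A2 _ A4] := A.
(* With [b = 6 * t * d] and [m = d / 16], [b_small] asks for [t < eps ^+ 2 / 96], and [t <= 4^-1]
   gives the bound [t ^+ 2 <= 16^-1] used for [g0]. *)
pose t := Num.min 4^-1 (eps ^+ 2 / 200).
have e2 : 0 < eps ^+ 2 by rewrite exprn_gt0.
have t0 : 0 < t.
  by rewrite lt_min; apply/andP; split; [rewrite invr_gt0|apply: divr_gt0].
have t4 : t <= 4^-1 by rewrite ge_min lexx.
have te : t <= eps ^+ 2 / 200 by rewrite ge_min lexx orbT.
have [N1 N1P] := eventually_all (g0 :: F) (fun g => cvg0_eventually_le t0 (stable g)).
(* Since sqrt 2 > 1, the value 1 is a lower bound from some index on. *)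
have [|N2 N2P] := @limn_einf_eventually R (fun n => norm2op (e n) (phi n g0 \- id)) 1.
  apply: lt_le_trans (A4 g0 g01); rewrite lte_fin.
  by rewrite -[ltLHS]sqrtr1 ltr_sqrt// ltr1n.
pose n := maxn N1 N2.
have {}N1P := N1P n (leq_maxl _ _); have {}N2P := N2P n (leq_maxr _ _).
have [dn eB] := A1 n; have dR : 0 < (d n)%:R :> R by rewrite ltr0n.
pose eb i : K n := iota n (e n i).
have eb_on i j : dot (eb i) (eb j) = (i == j)%:R by rewrite iotaD eB.1.
pose a := compression (rho n) eb.
have aE g : mxop (e n) (P n \o rho n g \o iota n) = a g.
  apply/matrixP => i j; rewrite !mxE /= -(iotaD n).
  apply/esym/eqP; rewrite -subr_eq0 -dotBl; apply/eqP; exact: Pproj.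
have close g : g \in g0 :: F -> entry_sq (mxop (e n) (phi n g) - a g) <= t ^+ 2 * (d n)%:R.
  by move=> gF; rewrite -aE -mxopB; apply: norm2_le => //; exact: N1P.
apply: (@compression_contradiction R G F eps kazhdan eps0 gens (K n) (rho n) gensP (rho_rep n)
  (d n) eb eb_on g0 (6 * t * (d n)%:R) g0N _ ((d n)%:R / 16)).
(* As [phi n g] is unitary, [d - entry_sq (a g)] is at most [t * entry_sq (a g) + (t ^+ 2 + t) * d].
   If [entry_sq (a g) <= d] this is at most [3 * t * d], which doubles to [b]; otherwise the left
   side is negative. *)
- move=> g gF; rewrite -/(a g) -/(entry_sq (a g)).
  have cl : entry_sq (mxop (e n) (phi n g) - a g) <= t ^+ 2 * (d n)%:R.
    by apply: close; rewrite inE gF orbT.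
  have := entry_sq_weighted (a g) (mxop (e n) (phi n g) - a g) t0.
  rewrite addrC subrK (entry_sq_unitary eB (A2 n g)).
  have := ler_wpM2l (_ : 0 <= 1 + t^-1) cl => /(_ _) H1.
  have {}H1 : (1 + t^-1) * entry_sq (mxop (e n) (phi n g) - a g) <= (t ^+ 2 + t) * (d n)%:R.
    have -> : (t ^+ 2 + t) * (d n)%:R = (1 + t^-1) * (t ^+ 2 * (d n)%:R).
      by field; rewrite gt_eqF.
    by apply: H1; rewrite addr_ge0// invr_ge0 ltW.
  have [ad|da] := leP (entry_sq (a g)) (d n)%:R; last by nra.
  by nra.
- by rewrite divr_gt0.
- have := ler_wpM2r (ltW dR) te; nra.
(* With weight 1, [d <= 2 * entry_sq (a g0 - 1) + 2 * t ^+ 2 * d], so [entry_sq (a g0 - 1)] is at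
   least [7 * d / 16], more than the required [d / 4]. *)
- rewrite -/(a g0) -/(entry_sq (a g0 - 1%:M)).
  have := close g0 (mem_head _ _).
  have := norm2_ge1 dn N2P; rewrite mxopB.
  have -> : mxop (e n) id = 1%:M by apply/matrixP => i j; rewrite !mxE eB.1 eq_sym.
  have := entry_sq_weighted (a g0 - 1%:M) (mxop (e n) (phi n g0) - a g0) (@ltr01 R).
  have -> : a g0 - 1%:M + (mxop (e n) (phi n g0) - a g0) = mxop (e n) (phi n g0) - 1%:M.
    by rewrite addrC addrA subrK.
  have t16 : t ^+ 2 <= 16^-1 by nra.
  by have := ler_wpM2r (ltW dR) t16; rewrite invr1; lra.
Qed.
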